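(* Let $n\ge 2$, $K=(2^n-1)(2^{2n-1}-1)$ and $A=3(K+1)$. For any irreducible automorphism $\Phi\in\mathrm{Out}(F_n)$, let $\lambda$ be the expansion factor of $\Phi$ and $\mu$ the expansion factor of $\Phi^{-1}$. Then $\mu\leq\lambda^A$.
   Context: $F_n$ is the free group of rank $n$. $\Phi\in\mathrm{Out}(F_n)$ is irreducible if there is no free product decomposition $F_n=A_1*\cdots*A_k*B$ with $k\geq 1$, the $A_j$ nontrivial proper free factors, such that $\Phi$ permutes the conjugacy classes of $A_1,\dots,A_k$. The expansion factor (growth rate) of an irreducible $\Phi$ is the Perron–Frobenius eigenvalue of the transition matrix of a train track representative of $\Phi$; equivalently, it is the exponential growth rate of $\Phi$, i.e. the maximum over nontrivial conjugacy classes $c$ in $F_n$ of $\limsup_{k\to\infty}\|\Phi^k(c)\|^{1/k}$, where $\|\cdot\|$ is cyclically reduced word length with respect to a fixed basis. *)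

(* Defs.v *)
From HB Require Import structures.
From mathcomp Require Import all_boot all_order all_algebra.
From mathcomp Require Import generic_quotient perm.
From mathcomp Require Import boolp classical_sets reals.

Set Implicit Arguments.
Unset Strict Implicit.
Unset Printing Implicit Defensive.

Import Order.TTheory GRing.Theory Num.Theory.

Local Open Scope quotient_scope.
Local Open Scope classical_set_scope.
Local Open Scope group_scope.

(* Words over X and their formal inverses: the letter (x, true) stands for x *)
(* and (x, false) for x^-1.                                                  *)
Section Words.
Variable X : eqType.
Implicit Types (a b : X * bool) (u v w : seq (X * bool)).

Definition invl a : X * bool := (a.1, ~~ a.2).
Definition invw w := rev (map invl w).

Definition tight w := sorted (fun a b => b != invl a) w.

Definition push a w :=
  if w is b :: w' then if b == invl a then w' else a :: w else [:: a].
Definition tighten w := foldr push [::] w.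

Lemma invlK : involutive invl.
Proof. by case=> x b; rewrite /invl /= negbK. Qed.

Lemma invwK : involutive invw.
Proof. by move=> w; rewrite /invw map_rev revK mapK //; apply: invlK. Qed.

Lemma invw_cons a w : invw (a :: w) = rcons (invw w) (invl a).
Proof. by rewrite /invw /= rev_cons. Qed.

Lemma invw_cat u v : invw (u ++ v) = invw v ++ invw u.
Proof. by rewrite /invw map_cat rev_cat. Qed.

Lemma tight_push a w : tight w -> tight (push a w).
Proof.
case: w => [|b w] //= tw; case: ifP => [_|/negbT nb]; first exact: path_sorted tw.
by rewrite /= nb.
Qed.

Lemma tight_foldr u w : tight w -> tight (foldr push w u).
Proof. by move=> tw; elim: u => //= a u; apply: tight_push. Qed.

Lemma tight_tighten w : tight (tighten w).
Proof. exact: tight_foldr. Qed.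

Lemma tighten_id w : tight w -> tighten w = w.
Proof.
elim: w => //= a w IHw tw; rewrite IHw; last exact: path_sorted tw.
by case: w tw {IHw} => //= b w /andP[/negPf-> _].
Qed.

Lemma pushK a w : tight w -> push a (push (invl a) w) = w.
Proof.
case: w => [|b w] /=; first by rewrite eqxx.
rewrite invlK; case: (eqVneq b a) => [->|_] tw /=; last by rewrite eqxx.
by case: w tw => //= c w /andP[/negPf-> _].
Qed.

Lemma foldr_push_tighten u w :
  tight w -> foldr push w (tighten u) = foldr push w u.
Proof.
move=> tw; elim: u => //= a u <-; case: (tighten u) => //= b v.
case: eqP => //= ->; rewrite pushK //; exact: tight_foldr.
Qed.

Lemma tighten_cat u v : tighten (u ++ v) = foldr push (tighten v) u.
Proof. by rewrite /tighten foldr_cat. Qed.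

Lemma tighten_catl u v : tighten (tighten u ++ v) = tighten (u ++ v).
Proof.
rewrite !tighten_cat foldr_push_tighten //; exact: tight_tighten.
Qed.

Lemma tighten_catr u v : tighten (u ++ tighten v) = tighten (u ++ v).
Proof.
by rewrite !tighten_cat (tighten_id (tight_tighten v)).
Qed.

Lemma tight_invw w : tight w -> tight (invw w).
Proof.
rewrite /tight /invw rev_sorted sorted_map; apply: sub_sorted => a b /=.
by rewrite invlK eq_sym.
Qed.

Lemma tighten_invwl w : tighten (invw w ++ w) = [::].
Proof.
elim: w => //= a w IHw; rewrite invw_cons cat_rcons tighten_cat /=.
rewrite -[X in push X _]/(invl a) -{2}[a]invlK pushK; last exact: tight_tighten.
by rewrite -tighten_cat.
Qed.

Lemma tighten_invwr w : tighten (w ++ invw w) = [::].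
Proof. by rewrite -{1}[w]invwK tighten_invwl. Qed.

End Words.

(* The free group on X, realised as the set of reduced words. *)
Record freegroup (X : choiceType) := FreeGroup {
  word :> seq (X * bool);
  word_tight : tight word
}.

HB.instance Definition _ (X : choiceType) := [isSub for @word X].
HB.instance Definition _ (X : choiceType) := [Choice of freegroup X by <:].

Section FreeGroup.
Variable X : choiceType.
Implicit Types u v w : freegroup X.

Definition redword (s : seq (X * bool)) : freegroup X :=
  FreeGroup (tight_tighten s).

Definition fg_one : freegroup X := redword [::].
Definition fg_mul u v : freegroup X := redword (word u ++ word v).
Definition fg_inv u : freegroup X := FreeGroup (tight_invw (word_tight u)).

Lemma fg_mulA : associative fg_mul.
Proof.
by move=> u v w; apply/val_inj; rewrite /= tighten_catl tighten_catr catA.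
Qed.
Lemma fg_mul1 : left_id fg_one fg_mul.
Proof. by move=> u; apply/val_inj; rewrite /= tighten_id ?word_tight. Qed.
Lemma fg_mulr1 : right_id fg_one fg_mul.
Proof. by move=> u; apply/val_inj; rewrite /= cats0 tighten_id ?word_tight. Qed.
Lemma fg_mulV : left_inverse fg_one fg_inv fg_mul.
Proof. by move=> u; apply/val_inj; rewrite /= tighten_invwl. Qed.
Lemma fg_mulrV : right_inverse fg_one fg_inv fg_mul.
Proof. by move=> u; apply/val_inj; rewrite /= tighten_invwr. Qed.

HB.instance Definition _ := isGroup.Build (freegroup X)
  fg_mulA fg_mul1 fg_mulr1 fg_mulV fg_mulrV.

End FreeGroup.

Definition Fr (n : nat) : groupType := freegroup 'I_n.

Record aut (G : groupType) := Aut {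
  aut_fun :> G -> G;
  aut_finv : G -> G;
  autM : {morph aut_fun : x y / x * y};
  autK : cancel aut_fun aut_finv;
  autVK : cancel aut_finv aut_fun
}.

HB.instance Definition _ (G : groupType) := gen_eqMixin (aut G).
HB.instance Definition _ (G : groupType) := gen_choiceMixin (aut G).

Section Out.
Variable G : groupType.
Implicit Types phi psi : aut G.

Lemma aut_finvM phi : {morph aut_finv phi : x y / x * y}.
Proof. by move=> x y; apply: (can_inj (autK phi)); rewrite autM !autVK. Qed.

Lemma autV phi x : phi x^-1 = (phi x)^-1.
Proof.
apply: (mulIg (phi x)); rewrite -autM !mulVg.
by apply: (mulIg (phi 1)); rewrite -autM !mul1g.
Qed.

Lemma autJ phi x y : phi (x ^ y) = phi x ^ phi y.
Proof. by rewrite !conjgE !autM autV. Qed.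

Definition inv_aut phi : aut G := Aut (@aut_finvM phi) (autVK phi) (autK phi).

Definition outer_eq phi psi : bool :=
  `[< exists g : G, forall x, psi x = (phi x) ^ g >].

Lemma outer_eq_refl : reflexive outer_eq.
Proof. by move=> phi; apply/asboolP; exists 1 => x; rewrite conjg1. Qed.

Lemma outer_eq_sym : symmetric outer_eq.
Proof.
move=> phi psi; apply: asbool_equiv_eq; split=> -[g e]; exists g^-1 => x;
  by rewrite e conjgK.
Qed.

Lemma outer_eq_trans : transitive outer_eq.
Proof.
move=> psi phi chi /asboolP[g e] /asboolP[h e']; apply/asboolP.
by exists (g * h) => x; rewrite e' e conjgM.
Qed.

Canonical outer_equiv :=
  EquivRel outer_eq outer_eq_refl outer_eq_sym outer_eq_trans.

(* Out(G), the automorphisms of G modulo the inner ones *)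
Definition Out := {eq_quot outer_equiv}.

Definition out_class phi : Out := (\pi_Out phi)%qT.

Definition out_inv (Phi : Out) : Out := out_class (inv_aut (repr Phi)).

Lemma out_classP phi psi :
  out_class phi = out_class psi <-> exists g : G, forall x, psi x = (phi x) ^ g.
Proof.
split=> [/eqmodP/asboolP //|h]; exact/eqmodP/asboolP.
Qed.

Lemma inv_aut_outer phi psi :
  out_class phi = out_class psi ->
  out_class (inv_aut phi) = out_class (inv_aut psi).
Proof.
move=> /out_classP[g e]; apply/out_classP; exists (aut_finv phi g^-1) => x /=.
by apply: (can_inj (autK psi)); rewrite autVK e autJ !autVK conjgKV.
Qed.

Lemma out_invE phi : out_inv (out_class phi) = out_class (inv_aut phi).
Proof. by apply: inv_aut_outer; rewrite /out_class reprK. Qed.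

End Out.

Section Irreducible.
Variable G : groupType.

Definition subgroup (A : set G) :=
  A 1 /\ forall x y : G, A x -> A y -> A (x * y^-1).

(* G is the internal free product of the family A of its subgroups: they     *)
(* generate G, and no nonempty alternating product of nontrivial elements of *)
(* the factors is trivial.                                                   *)
Definition free_product (I : eqType) (A : I -> set G) :=
  [/\ forall i, subgroup (A i),
      forall g : G, exists s : seq (I * G),
        (forall p, p \in s -> A p.1 p.2) /\ g = \prod_(p <- s) p.2
    & forall s : seq (I * G), s != [::] ->
        (forall p, p \in s -> A p.1 p.2 /\ p.2 != 1) ->
        sorted (fun p q => p.1 != q.1) s -> \prod_(p <- s) p.2 != 1].

Definition conj_set (A : set G) (g : G) : set G := [set x ^ g | x in A].

(* phi permutes the conjugacy classes of the A j. *)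
Definition permutes_classes k (A : 'I_k -> set G) (phi : aut G) :=
  exists s : {perm 'I_k}, forall j, exists g : G,
    phi @` A j = conj_set (A (s j)) g.

Lemma permutes_classes_outer k (A : 'I_k -> set G) (phi psi : aut G) :
  out_class phi = out_class psi ->
  permutes_classes A phi -> permutes_classes A psi.
Proof.
move=> /out_classP[g e] [s sP]; exists s => j; have [h hP] := sP j.
exists (h * g); rewrite (_ : psi @` A j = conj_set (phi @` A j) g).
  rewrite hP; apply/seteqP; split=> x /=.
    by case=> _ [y Ay <-] <-; exists y; rewrite // conjgM.
  by case=> y Ay <-; exists (y ^ h); [exists y | rewrite conjgM].
apply/seteqP; split=> x /=.
  by case=> y Ay <-; exists (phi y); [exists y | rewrite e].
by case=> _ [y Ay <-] <-; exists y; rewrite // e.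
Qed.

(* The cofactor B, indexed by None, is allowed to be trivial. *)
Definition irreducible_out (Phi : Out G) :=
  ~ exists k (A : 'I_k -> set G) (B : set G),
      [/\ (0 < k)%N,
          free_product (fun i : option 'I_k => if i is Some j then A j else B),
          forall j, A j <> [set 1] /\ A j <> [set: G]
        & permutes_classes A (repr Phi)].

End Irreducible.

(* Finite graphs. The oriented edges are the letters over edge: (e, true) is *)
(* e and (e, false) is e reversed.                                           *)
Record graph := Graph {
  vertex : finType;
  edge : finType;
  src : edge -> vertex;
  tgt : edge -> vertex
}.

Section Graph.
Variable G : graph.

Definition origin (a : edge G * bool) := if a.2 then src a.1 else tgt a.1.
Definition terminus (a : edge G * bool) := origin (invl a).

Fixpoint edge_path (u : vertex G) (w : seq (edge G * bool)) (v : vertex G) :=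
  if w is a :: w' then (origin a == u) && edge_path (terminus a) w' v
  else u == v.

Lemma edge_path_cat u v z w w' :
  edge_path u w v -> edge_path v w' z -> edge_path u (w ++ w') z.
Proof.
elim: w u => [|a w IHw] u /= => [/eqP-> //|/andP[-> pw] pw' /=].
exact: IHw.
Qed.

Lemma edge_path_invw u v w : edge_path u w v -> edge_path v (invw w) u.
Proof.
elim: w u => [|a w IHw] u /=; first by rewrite eq_sym.
case/andP=> /eqP<- pw; rewrite invw_cons -cats1.
by apply: edge_path_cat (IHw _ pw) _; rewrite /= /terminus invlK !eqxx.
Qed.

Lemma edge_path_tighten u v w : edge_path u w v -> edge_path u (tighten w) v.
Proof.
elim: w u => //= a w IHw u /andP[/eqP ua /IHw].
case: (tighten w) => [|b w'] /=; first by rewrite ua eqxx.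
case/andP=> /eqP ab pw'; case: eqP => [eb|_] /=; last by rewrite ua ab !eqxx.
by move: pw'; rewrite eb /terminus invlK ua.
Qed.

Definition connected := forall u v, exists w, edge_path u w v.

Definition valence (v : vertex G) := #|[pred a | origin a == v]|.

(* pi_1(G, v), as a subgroup of the free group on the edges of G: its        *)
(* elements are the tight closed edge paths at v.                            *)
Definition pi1 (v : vertex G) : set (freegroup (edge G)) :=
  [set w | edge_path v (word w) v].

End Graph.

(* A marking, given by the isomorphism that it induces from F_n onto pi_1.   *)
Record marking (n : nat) (G : graph) := Marking {
  basepoint : vertex G;
  mark :> Fr n -> freegroup (edge G);
  markM : {morph mark : x y / x * y};
  mark_inj : injective mark;
  mark_im : range mark = pi1 basepoint
}.

(* A map G -> G sending vertices to vertices and edges to nondegenerate      *)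
(* tight edge paths.                                                         *)
Record graph_map (G : graph) := GraphMap {
  vmap : vertex G -> vertex G;
  emap : edge G -> seq (edge G * bool);
  emap_path : forall e, edge_path (vmap (src e)) (emap e) (vmap (tgt e));
  emap_neq0 : forall e, emap e != [::];
  emap_tight : forall e, tight (emap e)
}.

Section GraphMap.
Variables (G : graph) (f : graph_map G).

Definition lmap (a : edge G * bool) :=
  if a.2 then emap f a.1 else invw (emap f a.1).

Definition wmap (w : seq (edge G * bool)) := flatten [seq lmap a | a <- w].

Definition f_sharp (w : freegroup (edge G)) : freegroup (edge G) :=
  redword (wmap (word w)).

(* f induces phi, up to an inner automorphism, on pi_1 identified with F_n   *)
(* by m; sigma is the path needed to compare the base points.                *)
Definition induces n (m : marking n G) (phi : aut (Fr n)) :=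
  exists sigma : freegroup (edge G),
    edge_path (basepoint m) (word sigma) (vmap f (basepoint m)) /\
    forall x, m (phi x) = sigma * f_sharp (m x) * sigma^-1.

Lemma induces_outer n (m : marking n G) (phi psi : aut (Fr n)) :
  out_class phi = out_class psi -> induces m phi -> induces m psi.
Proof.
move=> /out_classP[g e] [sigma [ps sP]].
have mV x : m x^-1 = (m x)^-1.
  apply: (mulIg (m x)); rewrite -markM !mulVg.
  by apply: (mulIg (m 1)); rewrite -markM !mul1g.
have pg : pi1 (basepoint m) (m g) by rewrite -mark_im; exists g.
exists ((m g)^-1 * sigma); split.
  exact/edge_path_tighten/(edge_path_cat (edge_path_invw pg)).
by move=> x; rewrite e conjgE !markM mV sP invgM invgK !mulgA.
Qed.

Definition represents n (m : marking n G) (Phi : Out (Fr n)) :=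
  induces m (repr Phi).

Definition train_track :=
  forall (k : nat) (e : edge G), tight (iter k wmap [:: (e, true)]).

(* The (i, j) entry counts the occurrences of the i-th edge, in either       *)
(* direction, in the image of the j-th edge.                                 *)
Definition transition_mx (R : realType) : 'M[R]_#|edge G| :=
  \matrix_(i, j)
    (count (fun a => a.1 == enum_val i) (emap f (enum_val j)))%:R%R.

End GraphMap.

Local Open Scope ring_scope.

Definition irreducible_mx (R : realType) n (M : 'M[R]_n) :=
  forall i j, exists2 N, (0 < N)%N & 0 < (M ^+ N) i j.

(* The eigenvalue of an irreducible nonnegative matrix that has a positive   *)
(* eigenvector.                                                              *)
Definition PF_eigenvalue (R : realType) n (M : 'M[R]_n) (lam : R) :=
  [/\ forall i j, 0 <= M i j, irreducible_mx M
    & exists v : 'rV[R]_n, (forall j, 0 < v 0 j) /\ v *m M = lam *: v].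

(* lam is the Perron-Frobenius eigenvalue of the transition matrix of a train *)
(* track representative of Phi. It is the exponential growth rate of Phi on   *)
(* conjugacy classes, so it does not depend on the representative.            *)
Definition expansion_factor (R : realType) n (Phi : Out (Fr n)) (lam : R) :=
  exists (G : graph) (m : marking n G) (f : graph_map G),
    [/\ connected G, forall v : vertex G, (2 <= valence v)%N,
        represents f m Phi, train_track f
      & PF_eigenvalue (transition_mx f R) lam].

(* Main.v *)
Require Import Defs.
From mathcomp Require Import all_boot all_order all_algebra.
From mathcomp Require Import boolp classical_sets reals.
From mathcomp Require Import zify ring lra.

Set Implicit Arguments.
Unset Strict Implicit.
Unset Printing Implicit Defensive.

Import Order.TTheory GRing.Theory Num.Theory.

Local Open Scope ring_scope.

(** Let f be a train track map for Phi on the marked graph G. Give the edges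
    of G the lengths v of a left Perron-Frobenius eigenvector, so that f
    stretches every edge exactly by lam. The point is an inequality in the
    reverse direction: for some integer N that is at most A, a loop a and the
    cyclically tight loop b homotopic to f(a) satisfy
      lam * length(a) <= lam ^ N * length(b)
    ([backward_length_bound]). It says that one application of the inverse of
    Phi multiplies lengths of conjugacy classes by at most lam ^ (N - 1). A
    train track map for the inverse stretches a legal loop by exactly mu at
    each step, and lengths in two marked graphs are comparable up to a
    constant, so mu <= lam ^ N ([train_track_growth_le]).

    The inequality comes from a potential. Take all double covers of G, one for
    each homomorphism from F_n to Z/2, and multiply the lengths of the nonzero
    mod 2 cycles that closed paths trace in them. There are 2 ^ n double covers
    and each has at most 2 ^ (2 n) - 1 nonzero cycles, because the lifts of n
    generators of F_n, two of each, span its cycles; N is the number of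
    factors, which is at most A ([card_cycles], [cycle_count_le]).

    Subdivide G so that f maps each new edge to a single edge, and let the new
    edges have the lengths of their images. This multiplies every length in G
    by lam, so the potential gets multiplied by at most lam ^ N. Then f becomes
    a composition of folds of pairs of edges, and f being a homotopy
    equivalence, the cycles of the subdivided graph correspond one to one to
    those of G, with trivial cycles corresponding to trivial ones
    ([image_cycle_surj], [image_cycle_inj]). Hence it is enough that under a
    fold no loop shrinks, in proportion, more than the potential does
    ([folding_inequality]).

    A fold shortens a loop by the total length of the turns that it folds
    ([fold_loop]). Let theta be the largest proportion that any loop loses.
    By cutting and reconnecting, it is attained by a loop that either repeats
    no edge or is a dumbbell, two loops joined by a bar that is passed twice,
    and that repeats no other edge ([extremal_candidate]). Such a loop lifts
    to a closed path that repeats no edge: the first kind to the trivial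
    double cover, the second to a double cover in which both ends of the
    dumbbell are unwrapped, so that the two passages of the bar lie in
    different sheets ([dumbbell_lift]). The lift is a cycle of the same
    length, which the fold shortens at least by the proportion theta; and no
    factor of the potential grows. *)

(** * Sums over the turns of a cyclic word *)

Section TurnSums.
Variables (R : realType) (T : Type).
Implicit Types (g h : T -> T -> R) (x y : T) (s t : seq T).

Fixpoint psum g x s := if s is y :: s' then g x y + psum g y s' else 0.

Definition csum g s := if s is x :: s' then psum g x (rcons s' x) else 0.

Lemma psum_cat g x s t : psum g x (s ++ t) = psum g x s + psum g (last x s) t.
Proof. by elim: s x => [|y s IHs] x /=; rewrite ?add0r // IHs addrA. Qed.

Lemma psum_join g x s y t z :
  psum g x (rcons (s ++ y :: t) z) =
  psum g x (rcons s y) + psum g y (rcons t z).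
Proof. by rewrite rcons_cat /= -cat_rcons psum_cat last_rcons. Qed.

Lemma csum_catC g s t : csum g (s ++ t) = csum g (t ++ s).
Proof.
case: s t => [|x s] [|y t]; rewrite ?cats0 //= !psum_join; exact: addrC.
Qed.

Lemma csum_rot g n s : csum g (rot n s) = csum g s.
Proof. by rewrite /rot csum_catC cat_take_drop. Qed.

Lemma psumB g h c x s :
  psum (fun a b => g a b - c * h a b) x s = psum g x s - c * psum h x s.
Proof.
elim: s x => [|y s IHs] x /=; first by rewrite mulr0 subr0.
by rewrite IHs mulrDr; ring.
Qed.

Lemma csumB g h c s :
  csum (fun a b => g a b - c * h a b) s = csum g s - c * csum h s.
Proof. by case: s => [|x s] /=; rewrite ?mulr0 ?subr0 // psumB. Qed.

Lemma psum_ge0 g x s : (forall a b, 0 < g a b) -> 0 <= psum g x s.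
Proof.
by move=> g0; elim: s x => //= y s IHs x; rewrite addr_ge0 // ltW.
Qed.

Lemma csum_gt0 g s : (forall a b, 0 < g a b) -> (0 < size s)%N -> 0 < csum g s.
Proof.
move=> g0; case: s => // x s _ /=; case: s => [|y s] /=; first by rewrite addr0.
by rewrite ltr_wpDr // psum_ge0.
Qed.

End TurnSums.

Lemma path_join (T : Type) (e : rel T) x s y t z :
  path e x (rcons (s ++ y :: t) z) =
  path e x (rcons s y) && path e y (rcons t z).
Proof. by rewrite rcons_cat /= -cat_rcons cat_path last_rcons. Qed.

Lemma cycle_catC (T : Type) (e : rel T) s t : cycle e (s ++ t) = cycle e (t ++ s).
Proof.
case: s t => [|x s] [|y t]; rewrite ?cats0 //= !path_join; exact: andbC.
Qed.

Lemma not_uniq_split (T : eqType) (s : seq T) :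
  ~~ uniq s -> exists x p q r, s = p ++ x :: q ++ x :: r.
Proof.
elim: s => //= x s IHs; rewrite negb_and negbK; case/orP=> [|/IHs].
  by case/splitPr=> q r; exists x, [::], q, r.
by case=> y [p [q [r ->]]]; exists y, (x :: p), q, r.
Qed.

Lemma seq_argmax (R : realType) (T : eqType) (h : T -> R) (s : seq T) :
  s != [::] -> exists2 x, x \in s & forall y, y \in s -> h y <= h x.
Proof.
elim: s => // x s IHs _; case: (altP (s =P [::])) => [->|/IHs[y sy ymax]].
  by exists x; rewrite ?mem_head // => y; rewrite inE => /eqP->.
case: (lerP (h x) (h y)) => [xy|/ltW yx].
  exists y; first by rewrite inE sy orbT.
  by move=> z; rewrite inE => /predU1P[->|/ymax].
exists x; rewrite ?mem_head // => z; rewrite inE => /predU1P[->//|/ymax zy].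
exact: le_trans zy yx.
Qed.

Lemma invl_neq (X : eqType) (a : X * bool) : invl a != a.
Proof. by case: a => x [] /=; rewrite /invl xpair_eqE andbF. Qed.

Lemma mem_invw (X : eqType) (a : X * bool) w : (a \in invw w) = (invl a \in w).
Proof.
by rewrite mem_rev -{1}[a]invlK mem_map //; apply: inv_inj (@invlK _).
Qed.

Lemma size_invw (X : eqType) (w : seq (X * bool)) : size (invw w) = size w.
Proof. by rewrite size_rev size_map. Qed.

(** * Loops with the largest turn ratio *)

Section ExtremalLoops.
Variables (R : realType) (E : finType).
Local Notation letter := (E * bool)%type.
Variable step : rel letter.
Hypothesis step_sym : forall a b, step a b = step (invl b) (invl a).
Implicit Types (g h : letter -> letter -> R) (x y : letter).
Implicit Types b c d p q r u v w : seq letter.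

Definition turn_sym g := forall x y, g x y = g (invl y) (invl x).

Lemma path_flip x s y :
  path step x (rcons s y) = path step (invl y) (rcons (invw s) (invl x)).
Proof.
elim: s x => [|z s IHs] x /=; first by rewrite !andbT step_sym.
by rewrite invw_cons -[rcons (invw s) _]cats1 path_join -IHs /= andbT -step_sym andbC.
Qed.

Lemma psum_flip g x s y : turn_sym g ->
  psum g x (rcons s y) = psum g (invl y) (rcons (invw s) (invl x)).
Proof.
move=> gsym; elim: s x => [|z s IHs] x /=; first by rewrite !addr0 gsym.
by rewrite invw_cons -[rcons (invw s) _]cats1 psum_join -IHs /= addr0 -gsym addrC.
Qed.

(** Cutting a loop at a repeated letter writes it as the sum of two shorter
    loops, so the largest ratio of two turn sums over all loops is already its
    maximum over the finitely many loops without repeated letters. *)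
Lemma max_ratio g h w0 : (forall x y, 0 < h x y) ->
  w0 != [::] -> cycle step w0 ->
  exists theta, (forall w, cycle step w -> csum g w <= theta * csum h w) /\
    exists w, [/\ w != [::], cycle step w & csum g w = theta * csum h w].
Proof.
move=> h0 w0n cw0.
(* U contains all words without repeated letters *)
pose U : seq (seq letter) :=
  flatten [seq [seq val t | t <- enum {: k.-tuple letter}]
          | k <- iota 0 #|{: letter}|.+1].
have inU w : uniq w -> w \in U.
  move=> uw; apply/flatten_mapP; exists (size w).
    by rewrite mem_iota /= add0n ltnS -(card_uniqP uw) max_card.
  by apply/mapP; exists (in_tuple w); rewrite ?mem_enum.
pose V := [seq w <- U | [&& w != [::], cycle step w & uniq w]].
have split_loop w : cycle step w -> ~~ uniq w -> exists w1 w2,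
    [/\ w1 != [::], w2 != [::], cycle step w1, cycle step w2
      & (size w1 < size w)%N /\ (size w2 < size w)%N] /\
    forall f, csum f w = csum f w1 + csum f w2 :> R.
  move=> cw /not_uniq_split[x [p [q [r ew]]]].
  exists (x :: q), (x :: r ++ p); move: cw; rewrite ew cycle_catC /= -catA /=.
  rewrite path_join => /andP[cq cr]; split; first split=> //=.
    by rewrite !size_cat /= !size_cat /=; lia.
  by move=> f; rewrite csum_catC /= -catA /= psum_join.
have exV w : w != [::] -> cycle step w -> exists v, v \in V.
  have [k] := ubnP (size w); elim: k w => // k IHk w /ltnSE wk wn cw.
  have [uw|nuw] := boolP (uniq w); first by exists w; rewrite mem_filter wn cw uw inU.
  have [w1 [w2 [[w1n _ cw1 _ [sz1 _]] _]]] := split_loop _ cw nuw.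
  by apply: (IHk w1) => //; apply: leq_trans sz1 wk.
have [v0 Vv0] := exV _ w0n cw0.
have /(seq_argmax (fun w => csum g w / csum h w)) [v Vv vmax] : V != [::].
  by case: (V) Vv0.
move: (Vv); rewrite mem_filter => /andP[/and3P[vn cv uv] _].
exists (csum g v / csum h v); split; last first.
  by exists v; split=> //; rewrite divfK // gt_eqF // csum_gt0 // lt0n size_eq0.
move=> w; have [k] := ubnP (size w); elim: k w => // k IHk w /ltnSE wk cw.
have [->|wn] := eqVneq w [::]; first by rewrite /= mulr0.
have [uw|nuw] := boolP (uniq w).
  rewrite -ler_pdivrMr ?csum_gt0 ?lt0n ?size_eq0 //; apply: vmax.
  by rewrite mem_filter wn cw uw inU.
have [w1 [w2 [[_ _ cw1 cw2 [sz1 sz2]] csE]]] := split_loop _ cw nuw.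
rewrite !csE mulrDr lerD // IHk //.
  exact: leq_trans sz1 wk.
exact: leq_trans sz2 wk.
Qed.

Definition simple w := uniq (map fst w).

(** The second kind of candidate is a dumbbell: the loops b and d joined by the
    bar u. *)
Definition candidate w := simple w \/ exists b u d,
  [/\ w = b ++ u ++ d ++ invw u, u != [::] & simple (b ++ u ++ d)].

Lemma simpleP w : uniq w -> (forall x, x \in w -> invl x \notin w) -> simple w.
Proof.
move=> uw nw; rewrite /simple map_inj_in_uniq // => -[e s] [e' s'] we we' /= ee.
move: we'; rewrite -{}ee => we'; have [->//|ss] := eqVneq s s'.
by have:= nw _ we; rewrite /invl /= (_ : ~~ s = s') ?we' //; case: s s' ss {we we'} => [] [].
Qed.

Lemma not_simple_split w : uniq w -> ~~ simple w ->
  exists x p q r, w = p ++ x :: q ++ invl x :: r /\ simple q.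
Proof.
elim: w => //= x w IHw /andP[xw uw].
have [sw|nsw _] := boolP (simple w); last first.
  have [y [p [q [r [-> sq]]]]] := IHw uw nsw.
  by exists y, (x :: p), q, r.
rewrite /simple /= -/(simple w) sw andbT negbK => /mapP[y wy xy].
have eyx : y = invl x.
  case: x y xy xw wy => e s [e' s'] /= <- xw wy; rewrite /invl /=.
  by case: s s' xw wy => [] [] // /negPf->.
move: wy sw; rewrite eyx => wy; case/splitPr: wy => q r.
rewrite /simple map_cat cat_uniq => /andP[sq _].
by exists x, [::], q, r.
Qed.

Section MinimalZeroLoop.
Variable g : letter -> letter -> R.
Hypothesis gsym : turn_sym g.
Hypothesis g_le0 : forall w, cycle step w -> csum g w <= 0.

Definition zero_loop w := [/\ w != [::], cycle step w & csum g w = 0].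
Definition minimal_zero_loop w :=
  zero_loop w /\ forall w', zero_loop w' -> (size w <= size w')%N.

(** Otherwise the loop can be cut at a repeated letter into two shorter loops,
    whose nonpositive sums add up to zero. *)
Lemma minimal_uniq w : minimal_zero_loop w -> uniq w.
Proof.
move=> [[wn cw sw] wmin]; apply/negPn/negP=> /not_uniq_split[x [p [q [r ew]]]].
move: cw sw wmin; rewrite ew cycle_catC csum_catC /= -catA /=.
rewrite path_join psum_join => /andP[cq cr] sum0 wmin.
have gq := g_le0 (w := x :: q) cq; have gr := g_le0 (w := x :: r ++ p) cr.
have : zero_loop (x :: q) by split=> //; move: gq gr sum0 => /=; lra.
by move/wmin; rewrite !size_cat /= !size_cat /=; lia.
Qed.

Lemma minimal_catC p q : minimal_zero_loop (p ++ q) -> minimal_zero_loop (q ++ p).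
Proof.
move=> [[pqn cpq spq] mpq]; split; last first.
  by move=> w /mpq; rewrite !size_cat addnC.
split; rewrite 1?cycle_catC 1?csum_catC //.
by case: p q pqn {cpq spq mpq} => [|? ?] [|? ?].
Qed.

(** A segment between the two passages of an edge in opposite directions can be
    run backwards. *)
Lemma minimal_flip x b c : minimal_zero_loop (x :: b ++ invl x :: c) ->
  minimal_zero_loop (x :: invw b ++ invl x :: c).
Proof.
move=> [[_ /= cw sw] wmin]; move: cw sw; rewrite path_join psum_join => cw sw.
split; last by move=> w /wmin; rewrite /= !size_cat size_invw.
by split; rewrite //= ?path_join ?psum_join 1?path_flip 1?psum_flip // invwK !invlK.
Qed.

Lemma minimal_flip_in p x b c : minimal_zero_loop (p ++ x :: b ++ invl x :: c) ->
  minimal_zero_loop (p ++ x :: invw b ++ invl x :: c).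
Proof.
move=> /minimal_catC; rewrite /= -catA => /minimal_flip mw.
by apply: minimal_catC; rewrite /= -catA.
Qed.

(** If a minimal zero loop passes e and f in both directions in the order
    e, e^-1, f, f^-1, then its two connecting segments can be exchanged: the
    two loops that use one of them twice have the same total turn sum and
    length as two copies of the loop, so that they too are minimal zero
    loops. *)
Lemma minimal_double e b c1 f d c2 :
  minimal_zero_loop (e :: b ++ invl e :: c1 ++ f :: d ++ invl f :: c2) ->
  minimal_zero_loop (e :: b ++ invl e :: c1 ++ f :: d ++ invl f :: invw c1).
Proof.
move=> [[_ /= cw sw] wmin].
set L1 := e :: _; pose L2 := e :: b ++ invl e :: invw c2 ++ f :: d ++ invl f :: c2.
move: cw sw; rewrite !path_join !psum_join => /and4P[p1 p2 p3 p4] sum0.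
have c1E : cycle step L1.
  by rewrite /= !path_join p1 p2 p3 path_flip invwK invlK.
have c2E : cycle step L2.
  by rewrite /= !path_join p1 p3 p4 path_flip invwK !invlK p4.
have := g_le0 c1E; have := g_le0 c2E; rewrite /= !psum_join.
rewrite [psum g (invl e) (rcons (invw c2) f)]psum_flip // invwK invlK.
rewrite [psum g (invl f) (rcons (invw c1) e)]psum_flip // invwK !invlK => g2 g1.
have z1 : zero_loop L1.
  split=> //=; rewrite !psum_join.
  by rewrite [psum g (invl f) (rcons (invw c1) e)]psum_flip // invwK !invlK; lra.
have z2 : zero_loop L2.
  split=> //=; rewrite !psum_join.
  by rewrite [psum g (invl e) (rcons (invw c2) f)]psum_flip // invwK !invlK; lra.
split=> // w zw; have := wmin _ zw; apply: leq_trans.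
move: (wmin _ z2); do 9 rewrite /= ?size_cat ?size_invw; lia.
Qed.

(** An edge that occurs twice would be repeated in the same direction, either in
    the loop or after running one end of the dumbbell backwards. *)
Lemma minimal_dumbbell b u d :
  minimal_zero_loop (b ++ u ++ d ++ invw u) -> u != [::] ->
  simple b -> simple d -> simple (b ++ u ++ d).
Proof.
move=> mw un sb sd; have := minimal_uniq mw.
case/lastP: u un mw => // u x _ mw uw.
move: (mw); rewrite /invw map_rcons rev_rcons -/(invw u) cat_rcons catA.
move/minimal_flip_in/minimal_uniq; rewrite -catA -cat_rcons -[invl x :: _]cat1s.
have -> : [:: invl x] ++ invw u = invw (rcons u x) by rewrite -cats1 invw_cat.
set v := rcons u x in uw *; move=> uw'.
have nb (y : E) : y \in map fst b -> y \in map fst v -> False.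
  case/mapP=> -[e s] be -> /mapP[[e' s'] ve /= ee]; rewrite -{}ee in ve.
  move: uw; rewrite cat_uniq => /and3P[_ /hasP[]]; have [ss|ss] := eqVneq s s'.
    by exists (e, s); rewrite // mem_cat ss ve.
  exists (e, s); rewrite // !mem_cat mem_invw /invl /= (_ : ~~ s = s') ?ve ?orbT //.
  by case: s s' ss {be ve} => [] [].
have nd (y : E) : y \in map fst d -> y \in map fst v -> False.
  case/mapP=> -[e s] de -> /mapP[[e' s'] ve /= ee]; rewrite -{}ee in ve.
  move: uw; rewrite cat_uniq => /and3P[_ _]; have [ss|ss] := eqVneq s s'.
    rewrite cat_uniq => /and3P[_ /hasP[]]; exists (e, s); rewrite ?ss //.
    by rewrite mem_cat -ss de.
  rewrite catA cat_uniq => /and3P[_ /hasP[]]; exists (e, s); last by rewrite mem_cat de orbT.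
  rewrite mem_invw /invl /= (_ : ~~ s = s') //.
  by case: s s' ss {de ve} => [] [].
have nbd (y : E) : y \in map fst b -> y \in map fst d -> False.
  case/mapP=> -[e s] be -> /mapP[[e' s'] de /= ee]; rewrite -{}ee in de.
  have [ss|ss] := eqVneq s s'.
    move: uw; rewrite cat_uniq => /and3P[_ /hasP[]]; exists (e, s) => //.
    by rewrite !mem_cat ss de !orbT.
  move: uw'; rewrite cat_uniq => /and3P[_ /hasP[]]; exists (e, s) => //.
  rewrite !mem_cat mem_invw /invl /= (_ : ~~ s = s') ?de ?orbT //.
  by case: s s' ss {be de} => [] [].
have sv : simple v.
  apply: simpleP; first by move: uw; rewrite !cat_uniq => /and4P[_ _ ->].
  move=> y vy; apply/negP=> vy'; move: uw; rewrite catA cat_uniq => /and3P[_ H _].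
  case/hasP: H; exists y; first by rewrite mem_cat mem_invw vy' orbT.
  by rewrite /= mem_cat vy orbT.
rewrite /simple !map_cat !cat_uniq; apply/and4P; split=> //.
  apply/hasPn=> y; rewrite mem_cat => /orP[] yP; apply/negP=> yb; first exact: nb yb yP.
  exact: nbd yb yP.
by apply/andP; split=> //; apply/hasPn=> y yd; apply/negP=> yv; apply: nd yd yv.
Qed.

(** In a minimal zero loop that passes some edge twice, the innermost such pair
    closes off a simple segment b. The rest of the loop is either simple, and
    the loop is a dumbbell, or contains a second such segment d, and the two
    are joined into a dumbbell by using one connecting segment twice. *)
Lemma zero_loop_candidate w0 : zero_loop w0 ->
  exists2 w, zero_loop w & candidate w.
Proof.
move=> zw0; have exP : exists k, `[< exists2 w, zero_loop w & size w = k >].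
  by exists (size w0); apply/asboolP; exists w0.
have [w mw] : exists w, minimal_zero_loop w.
  case: (ex_minnP exP) => k /asboolP[w zw wk] kmin; exists w; split=> // w' zw'.
  by rewrite wk; apply: kmin; apply/asboolP; exists w'.
have [sw|/not_simple_split] := boolP (simple w).
  by exists w; [case: mw | left].
case=> [|f [p [b [r [ew sb]]]]]; first exact: minimal_uniq mw.
move: mw; rewrite {}ew => /minimal_catC; rewrite /= -catA /= => mw.
have [sc|nsc] := boolP (simple (r ++ p)).
  have := minimal_catC (p := [:: f]) mw.
  have -> : (b ++ invl f :: r ++ p) ++ [:: f] =
      b ++ [:: invl f] ++ (r ++ p) ++ invw [:: invl f].
    by rewrite /invw /= invlK /rev /= -!catA /= -!catA.
  move=> mw'; exists (b ++ [:: invl f] ++ (r ++ p) ++ invw [:: invl f]).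
    by case: mw'.
  by right; exists b, [:: invl f], (r ++ p); split=> //; apply: minimal_dumbbell.
have uc : uniq (r ++ p).
  by have := minimal_uniq mw; rewrite /= cat_uniq /= => /and5P[].
have [x [c1 [d [c2 [ec sd]]]]] := not_simple_split uc nsc.
move: mw; rewrite {}ec => /minimal_double /(minimal_catC (p := [:: f])) mw.
have eu : invw (invl f :: c1 ++ [:: x]) = invl x :: invw c1 ++ [:: f].
  by rewrite invw_cons invw_cat invlK -cats1.
have ew : (b ++ invl f :: c1 ++ x :: d ++ invl x :: invw c1) ++ [:: f] =
    b ++ (invl f :: c1 ++ [:: x]) ++ d ++ invw (invl f :: c1 ++ [:: x]).
  by rewrite eu; do 5 rewrite /= -?catA.
rewrite {}ew in mw.
exists (b ++ (invl f :: c1 ++ [:: x]) ++ d ++ invw (invl f :: c1 ++ [:: x])).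
  by case: mw.
by right; exists b, (invl f :: c1 ++ [:: x]), d; split=> //; apply: minimal_dumbbell.
Qed.

End MinimalZeroLoop.

(** The shape of an extremal loop that lets it lift to a double cover without
    running through any edge twice. *)
Lemma extremal_candidate g h w0 : turn_sym g -> turn_sym h ->
  (forall x y, 0 < h x y) -> w0 != [::] -> cycle step w0 ->
  exists theta, (forall w, cycle step w -> csum g w <= theta * csum h w) /\
    exists w, [/\ w != [::], cycle step w, csum g w = theta * csum h w
                & candidate w].
Proof.
move=> gs hs h0 w0n cw0; have [th [thmax [w1 [w1n cw1 w1E]]]] := max_ratio g h0 w0n cw0.
exists th; split=> //; pose k x y := g x y - th * h x y.
have ks : turn_sym k by move=> x y; rewrite /k gs hs.
have k0 w : cycle step w -> csum k w <= 0.
  by move=> /thmax; rewrite csumB subr_le0.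
have zw1 : zero_loop k w1 by split=> //; rewrite csumB w1E subrr.
have [w [wn cw sw] candw] := zero_loop_candidate ks k0 zw1.
by exists w; split=> //; apply/eqP; rewrite -subr_eq0 -csumB; apply/eqP.
Qed.

End ExtremalLoops.

(** * Words, substitutions and conjugacy in free groups *)

Section FreeReduction.
Variable X : choiceType.
Implicit Types (a : X * bool) (u v w : seq (X * bool)).

Lemma redword_cat u v : redword (u ++ v) = (redword u * redword v)%g.
Proof. by apply/val_inj; rewrite /= tighten_catl tighten_catr. Qed.

Lemma redword_invw u : redword (invw u) = ((redword u)^-1)%g.
Proof.
apply: (mulIg (redword u)); rewrite mulVg -redword_cat.
by apply/val_inj; rewrite /= tighten_invwl.
Qed.

Lemma redwordK (x : freegroup X) : redword (word x) = x.
Proof. by apply/val_inj; rewrite /= tighten_id // word_tight. Qed.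

Lemma redword_tighten w : redword (tighten w) = redword w.
Proof. by apply/val_inj; rewrite /= tighten_id // tight_tighten. Qed.

Lemma redword_inj u v : tight u -> tight v -> redword u = redword v -> u = v.
Proof. by move=> tu tv /(congr1 val) /=; rewrite !tighten_id. Qed.

Lemma redword_nil : redword [::] = 1%g :> freegroup X. Proof. by []. Qed.

Lemma cancel_pair u a v : redword (u ++ a :: invl a :: v) = redword (u ++ v).
Proof.
rewrite redword_cat -[a :: _]/([:: a; invl a] ++ v) redword_cat.
have -> : redword [:: a; invl a] = 1%g.
  by apply/val_inj; rewrite /= eqxx.
by rewrite mul1g -redword_cat.
Qed.

(** Functions of words that do not see the cancellation of one pair of inverse
    letters are functions on the free group. *)
Lemma tighten_invariant (T : Type) (F : seq (X * bool) -> T) :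
  (forall u a v, F (u ++ a :: invl a :: v) = F (u ++ v)) ->
  forall w, F (tighten w) = F w.
Proof.
move=> Fc w; suff H u : F (u ++ tighten w) = F (u ++ w) by apply: (H [::]).
elim: w u => //= a w IHw u; rewrite -cat_rcons -IHw cat_rcons.
case: (tighten w) => [//|b w'] /=; case: eqP => //= ->; by rewrite Fc.
Qed.

Lemma redword_invariant (T : Type) (F : seq (X * bool) -> T) :
  (forall u a v, F (u ++ a :: invl a :: v) = F (u ++ v)) ->
  forall u v, redword u = redword v -> F u = F v.
Proof.
move=> Fc u v /(congr1 val) /= uv.
by rewrite -(tighten_invariant Fc u) uv tighten_invariant.
Qed.

Definition conjw u w := exists z : freegroup X, redword u = (z * redword w * z^-1)%g.

Lemma conjw_refl w : conjw w w.
Proof. by exists 1%g; rewrite mul1g invg1 mulg1. Qed.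

Lemma conjw_redword u w : redword u = redword w -> conjw u w.
Proof. by move=> e; exists 1%g; rewrite mul1g invg1 mulg1. Qed.

Lemma conjw_sym u w : conjw u w -> conjw w u.
Proof.
by case=> z e; exists z^-1%g; rewrite e invgK !mulgA mulVg mul1g mulgVK.
Qed.

Lemma conjw_trans v u w : conjw u v -> conjw v w -> conjw u w.
Proof. by case=> z e [y e']; rewrite /conjw e e'; exists (z * y)%g; rewrite invgM !mulgA. Qed.

Lemma conjw_catC u v : conjw (u ++ v) (v ++ u).
Proof.
by exists (redword u); rewrite !redword_cat !mulgA mulgK.
Qed.

Lemma conjw_rot k w : conjw (rot k w) w.
Proof. by rewrite /rot -{3}[w](cat_take_drop k); apply: conjw_catC. Qed.

Lemma conjw_conj q w : conjw (q ++ w ++ invw q) w.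
Proof. by exists (redword q); rewrite !redword_cat redword_invw mulgA. Qed.

End FreeReduction.

Section Substitution.
Variables X Y : choiceType.
Implicit Types (s : X -> seq (Y * bool)) (w : seq (X * bool)).

Definition slet s (a : X * bool) := if a.2 then s a.1 else invw (s a.1).

Definition subst s w := flatten [seq slet s a | a <- w].

Lemma subst_cat s u v : subst s (u ++ v) = subst s u ++ subst s v.
Proof. by rewrite /subst map_cat flatten_cat. Qed.

Lemma slet_invl s a : slet s (invl a) = invw (slet s a).
Proof. by case: a => x [] //; rewrite /slet /= invwK. Qed.

Lemma subst_invw s w : subst s (invw w) = invw (subst s w).
Proof.
elim: w => //= a w IHw; rewrite invw_cons -cats1 subst_cat IHw.
by rewrite -[subst s (a :: w)]/(slet s a ++ subst s w) invw_cat /subst /= cats0 slet_invl.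
Qed.

Lemma redword_subst s u v :
  redword u = redword v -> redword (subst s u) = redword (subst s v).
Proof.
move=> uv; apply: (redword_invariant (F := fun w => redword (subst s w))) uv => {}u a {}v.
rewrite -[a :: _]/([:: a; invl a] ++ v) !subst_cat !redword_cat.
by rewrite redword_nil mulg1 slet_invl redword_invw mulgV mul1g.
Qed.

Lemma conjw_subst s u w : conjw u w -> conjw (subst s u) (subst s w).
Proof.
case=> z; rewrite -(redwordK z) -redword_invw -!redword_cat => /redword_subst e.
exists (redword (subst s (word z))).
by rewrite e !subst_cat !redword_cat subst_invw redword_invw.
Qed.

Definition relabel (phi : X -> Y) (a : X * bool) : Y * bool := (phi a.1, a.2).

Lemma map_relabel (phi : X -> Y) w :
  map (relabel phi) w = subst (fun e => [:: (phi e, true)]) w.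
Proof. by elim: w => //= -[e []] w ->. Qed.

Lemma conjw_relabel (phi : X -> Y) u v :
  conjw u v -> conjw (map (relabel phi) u) (map (relabel phi) v).
Proof. by rewrite !map_relabel; apply: conjw_subst. Qed.

End Substitution.

Lemma subst_comp (X Y Z : choiceType) (s : Y -> seq (Z * bool))
    (t : X -> seq (Y * bool)) w :
  subst s (subst t w) = subst (fun e => subst s (t e)) w.
Proof.
elim: w => //= a w IHw; rewrite -[subst t _]/(slet t a ++ subst t w) subst_cat IHw.
by congr (_ ++ _); rewrite /slet; case: a => e [] //=; rewrite subst_invw.
Qed.

(** * Weighted length *)

Section Length.
Variables (R : realType) (X : choiceType) (v : X -> R).
Hypothesis v0 : forall e, 0 <= v e.
Implicit Types w b u : seq (X * bool).

Definition len w : R := \sum_(a <- w) v a.1.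

Lemma len_cat u w : len (u ++ w) = len u + len w.
Proof. exact: big_cat. Qed.

Lemma len_cons a w : len (a :: w) = v a.1 + len w.
Proof. exact: big_cons. Qed.

Lemma len_nil : len [::] = 0.
Proof. exact: big_nil. Qed.

Lemma len_rcons a w : len (rcons w a) = len w + v a.1.
Proof. by rewrite -cats1 len_cat len_cons len_nil addr0. Qed.

Lemma len_ge0 w : 0 <= len w.
Proof. by apply: sumr_ge0. Qed.

Lemma len_invw w : len (invw w) = len w.
Proof.
elim: w => // a w IHw.
by rewrite invw_cons -cats1 len_cat IHw !len_cons len_nil addr0 addrC.
Qed.

Lemma len_catC u w : len (u ++ w) = len (w ++ u).
Proof. by rewrite !len_cat addrC. Qed.

Lemma len_tighten w : len (tighten w) <= len w.
Proof.
elim: w => //= a w IHw; rewrite len_cons.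
apply: (@le_trans _ _ (v a.1 + len (tighten w))); last by rewrite lerD2l.
case: (tighten w) => [|b w'] /=; first by rewrite len_cons.
case: ifP => _; last by rewrite len_cons.
by rewrite len_cons addrA lerDr addr_ge0.
Qed.

Definition reduced_step (a b : X * bool) := b != invl a.

Lemma cycle_pow e b k : @cycle (X * bool) e b -> sorted e (flatten (nseq k b)).
Proof.
case: b => [|x b] /= cb.
  by elim: k.
elim: k => //= k IHk.
case: k IHk => [_|k IHk] /=; first by rewrite cats0; move: cb; rewrite rcons_path => /andP[].
by rewrite -cat_rcons cat_path cb last_rcons; apply: IHk.
Qed.

(** The k-th powers of conjugate words stay conjugate by the same element,
    and a cyclically tight word has tight powers; comparing lengths for
    large k removes the contribution of the conjugator. *)
Lemma cyclic_len_min u b : cycle reduced_step b -> conjw u b -> len b <= len u.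
Proof.
move=> cb [z ez]; pose P w k := flatten (nseq k w).
have lenP w k : len (P w k) = k%:R * len w.
  elim: k => [|k IHk]; first by rewrite mul0r len_nil.
  by rewrite [P _ _]/(w ++ P w k) len_cat IHk -natr1 mulrDl mul1r addrC.
have ePz k : redword (P u k) = (z * redword (P b k) * z^-1)%g.
  elim: k => [|k IHk]; first by rewrite redword_nil mulg1 mulgV.
  rewrite [P u _]/(u ++ P u k) [P b _]/(b ++ P b k) !redword_cat IHk ez.
  by rewrite !mulgA mulgVK.
have le k : k%:R * len b <= k%:R * len u + (len (word z) + len (word z)).
  have eb : redword (P b k) = redword (invw (word z) ++ P u k ++ word z).
    rewrite !redword_cat redword_invw !redwordK ePz !mulgA mulVg mul1g.
    by rewrite mulgVK.
  have : P b k = tighten (invw (word z) ++ P u k ++ word z).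
    apply: redword_inj; rewrite ?tight_tighten ?redword_tighten //.
    exact: cycle_pow.
  rewrite -lenP => ->; apply: le_trans (len_tighten _) _.
  by rewrite !len_cat lenP len_invw; lra.
rewrite leNgt; apply/negP=> lt.
pose C := len (word z) + len (word z).
have C0 : 0 <= C by rewrite addr_ge0 // len_ge0.
have d0 : 0 < len b - len u by rewrite subr_gt0.
have := archi_boundP (divr_ge0 C0 (ltW d0)); set k := Num.bound _.
rewrite ltr_pdivrMr // => hk; have := le k; rewrite -/C; move: hk.
by rewrite mulrBr; lra.
Qed.

End Length.

Lemma len_subst (R : realType) (X Y : choiceType) (v : Y -> R)
    (s : X -> seq (Y * bool)) w :
  len v (subst s w) = len (fun e => len v (s e)) w.
Proof.
elim: w => [|a w IHw]; first by rewrite !len_nil.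
rewrite -[subst s _]/(slet s a ++ subst s w) len_cat IHw len_cons /slet.
by case: a => e []; rewrite ?len_invw.
Qed.

Lemma len_relabel (R : realType) (X Y : choiceType) (v : Y -> R) (phi : X -> Y) w :
  len v (map (relabel phi) w) = len (v \o phi) w.
Proof. by rewrite /len big_map. Qed.

(** * Mod 2 chains in double covers *)

Lemma bool_char2 (b : bool) : b + b = 0. Proof. by case: b. Qed.

Section Holonomy.
Variables (X : choiceType) (k : X -> bool).
Implicit Types w u : seq (X * bool).

Fixpoint hol w := if w is a :: w' then k a.1 (+) hol w' else false.

Lemma hol_cat u w : hol (u ++ w) = hol u (+) hol w.
Proof. by elim: u => //= a u ->; rewrite addbA. Qed.

Lemma hol_invw w : hol (invw w) = hol w.
Proof.
by elim: w => //= a w IHw; rewrite invw_cons -cats1 hol_cat IHw /= addbF addbC.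
Qed.

Lemma hol_redword u w : redword u = redword w -> hol u = hol w.
Proof.
move=> uw; apply: (redword_invariant (F := hol)) uw => {}u a v.
rewrite !hol_cat /=; by rewrite (addbA (k a.1)) addbb.
Qed.

Lemma hol_conjw u w : conjw u w -> hol u = hol w.
Proof.
case=> z; rewrite -(redwordK z) -redword_invw -!redword_cat => /hol_redword->.
by rewrite !hol_cat hol_invw addbAC addbb.
Qed.

End Holonomy.

Lemma eq_hol (X : choiceType) (k k' : X -> bool) : k =1 k' -> hol k =1 hol k'.
Proof. by move=> e; elim=> //= a w ->; rewrite e. Qed.

Lemma hol_subst (X Y : choiceType) (k : Y -> bool) (s : X -> seq (Y * bool)) w :
  hol k (subst s w) = hol (fun e => hol k (s e)) w.
Proof.
elim: w => // a w IHw; rewrite -[subst s _]/(slet s a ++ subst s w) hol_cat IHw /=.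
by rewrite /slet; case: a => e []; rewrite ?hol_invw.
Qed.

Lemma hol_relabel (X Y : choiceType) (k : Y -> bool) (phi : X -> Y) w :
  hol k (map (relabel phi) w) = hol (k \o phi) w.
Proof. by elim: w => //= a w ->. Qed.

(** The double cover of a graph with edges E that a cochain k : E -> bool
    defines has the edges E * bool, each named by the sheet of its initial
    point; [lifts k s w] lists the edges under the lift of w that starts in
    the sheet s, and [ch k s w] is the mod 2 chain of this lift. *)
Section Lifts.
Variables (E : finType) (k : E -> bool).
Implicit Types (w u : seq (E * bool)) (s : bool).
Local Notation chain := {ffun E * bool -> bool}.

Definition delta (x : E * bool) : chain := [ffun y => y == x].

Definition lift1 s (a : E * bool) := (a.1, if a.2 then s else s (+) k a.1).

Fixpoint lifts s w :=
  if w is a :: w' then lift1 s a :: lifts (s (+) k a.1) w' else [::].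

Definition ch s w : chain := \sum_(x <- lifts s w) delta x.

Lemma chain2 (c : chain) : c + c = 0.
Proof. by apply/ffunP=> x; rewrite !ffunE bool_char2. Qed.

Lemma lifts_cat s u w : lifts s (u ++ w) = lifts s u ++ lifts (s (+) hol k u) w.
Proof.
by elim: u s => [|a u IHu] s /=; rewrite ?addbF // IHu addbA.
Qed.

Lemma map_lifts s w : map fst (lifts s w) = map fst w.
Proof. by elim: w s => //= a w IHw s; rewrite IHw. Qed.

Lemma lifts_invw s w : lifts s (invw w) = rev (lifts (s (+) hol k w) w).
Proof.
elim: w s => // a w IHw s; rewrite invw_cons -cats1 lifts_cat hol_invw IHw /=.
rewrite rev_cons -cats1; congr (_ ++ _).
  by rewrite (addbC (k a.1)) addbA addbK.
by case: a => e []; rewrite /lift1 /= (addbC (k e)) addbA ?addbK.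
Qed.

Lemma lifts_negb s w : lifts (~~ s) w = [seq (x.1, ~~ x.2) | x <- lifts s w].
Proof.
elim: w s => //= a w IHw s; rewrite addNb IHw; congr (_ :: _).
by rewrite /lift1; case: a.2; rewrite ?addNb.
Qed.

Lemma ch_nil s : ch s [::] = 0. Proof. exact: big_nil. Qed.

Lemma ch_cons s a w : ch s (a :: w) = delta (lift1 s a) + ch (s (+) k a.1) w.
Proof. exact: big_cons. Qed.

Lemma ch_cat s u w : ch s (u ++ w) = ch s u + ch (s (+) hol k u) w.
Proof. by rewrite /ch lifts_cat big_cat. Qed.

Lemma ch_invw s w : ch s (invw w) = ch (s (+) hol k w) w.
Proof. by rewrite /ch lifts_invw; apply: perm_big; rewrite perm_rev. Qed.

Lemma ch_redword s u w : redword u = redword w -> ch s u = ch s w.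
Proof.
move=> uw; apply: (redword_invariant (F := ch s)) uw => {}u a v.
rewrite !ch_cat !ch_cons; congr (_ + _); rewrite addrA /= addbK.
rewrite -[RHS]add0r; congr (_ + _).
by case: a => e []; rewrite /lift1 /= ?addbK chain2.
Qed.

(** The two copies of the conjugating path cancel, as they lie in the same
    sheet when w has trivial holonomy. *)
Lemma ch_conjw s u w : conjw u w -> hol k w = false ->
  exists s', ch s u = ch s' w.
Proof.
case=> z; rewrite -(redwordK z) -redword_invw -!redword_cat => e hw.
exists (s (+) hol k (word z)); rewrite (ch_redword s e) !ch_cat ch_invw.
by rewrite hol_cat hw !addbF addbK addrC addrA chain2 add0r.
Qed.

Lemma ch_uniq s w : uniq (lifts s w) -> ch s w = [ffun x => x \in lifts s w].
Proof.
move=> ul; apply/ffunP=> x; rewrite /ch sum_ffunE ffunE.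
have [xl|xl] := boolP (x \in lifts s w).
  rewrite (bigD1_seq x) //= ffunE eqxx big1 // => y /negPf yx.
  by rewrite ffunE eq_sym yx.
rewrite big_seq big1 // => y yl; rewrite ffunE; apply/negbTE.
by apply: contraNneq xl => ->.
Qed.

End Lifts.

Lemma eq_ch (E : finType) (k k' : E -> bool) s w : k =1 k' -> ch k s w = ch k' s w.
Proof.
move=> e; elim: w s => [|a w IHw] s; first by rewrite !ch_nil.
by rewrite !ch_cons IHw /lift1 !e.
Qed.

Section ChainMap.
Variables (E L : finType) (k : L -> bool).
Implicit Types (s : E -> seq (L * bool)) (c d : {ffun E * bool -> bool}).

(** The chain map between double covers that a map sending edges to edge paths
    induces; k is the cochain of the target. *)
Definition subst_chain s c : {ffun L * bool -> bool} :=
  \sum_x (if c x then ch k x.2 (s x.1) else 0).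

Lemma subst_chainD s c d : subst_chain s (c + d) = subst_chain s c + subst_chain s d.
Proof.
rewrite /subst_chain -big_split /=; apply: eq_bigr => x _; rewrite ffunE.
by case: (c x) (d x) => [] []; rewrite ?addr0 ?add0r ?chain2.
Qed.

Lemma subst_chain0 s : subst_chain s 0 = 0.
Proof. by rewrite /subst_chain big1 // => x _; rewrite ffunE. Qed.

Lemma subst_chain_delta s x : subst_chain s (delta x) = ch k x.2 (s x.1).
Proof.
rewrite /subst_chain (bigD1 x) //= ffunE eqxx big1 ?addr0 // => y /negPf yx.
by rewrite ffunE yx.
Qed.

Lemma ch_subst s t w :
  ch k t (subst s w) = subst_chain s (ch (fun e => hol k (s e)) t w).
Proof.
elim: w t => [|a w IHw] t; first by rewrite !ch_nil subst_chain0.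
rewrite -[subst s _]/(slet s a ++ subst s w) ch_cat IHw ch_cons subst_chainD.
rewrite subst_chain_delta; case: a => e [] //=; rewrite /slet /= ch_invw.
by rewrite hol_invw.
Qed.

End ChainMap.

(** Pushing a chain forward along a map of edges that preserves orientations.
    A word of one positive letter stays in its sheet for every cochain, which
    is why the cochain can be taken to be trivial. *)
Definition push_chain (E L : finType) (phi : E -> L) :=
  subst_chain (fun=> false) (fun e : E => [:: (phi e, true)]).

Section PushChain.
Variables (E L : finType) (phi : E -> L).
Implicit Types (c : {ffun E * bool -> bool}).

Lemma push_chainE (k : L -> bool) :
  push_chain phi = subst_chain k (fun e : E => [:: (phi e, true)]).
Proof.
by apply/funext=> c; apply: eq_bigr => x _; rewrite !ch_cons !ch_nil.
Qed.

Lemma push_chain0 : push_chain phi 0 = 0.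
Proof. exact: subst_chain0. Qed.

Lemma push_ch (k : L -> bool) s w :
  push_chain phi (ch (k \o phi) s w) = ch k s (map (relabel phi) w).
Proof.
rewrite map_relabel ch_subst (push_chainE k); congr subst_chain.
by apply: eq_ch => e /=; rewrite addbF.
Qed.

End PushChain.

Lemma subst_chain_sum (E L : finType) (k : L -> bool) (s : E -> seq (L * bool))
    (I : finType) (F : I -> {ffun E * bool -> bool}) :
  subst_chain k s (\sum_i F i) = \sum_i subst_chain k s (F i).
Proof.
by apply: (big_morph _ (@subst_chainD _ _ k s) (@subst_chain0 _ _ k s)).
Qed.

Lemma push_chain_comp (E F L : finType) (phi : E -> F) (psi : F -> L) c :
  push_chain psi (push_chain phi c) = push_chain (psi \o phi) c.
Proof.
rewrite /push_chain {2}/subst_chain subst_chain_sum; apply: eq_bigr => x _.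
case: (c x); last by rewrite subst_chain0.
by rewrite !ch_cons !ch_nil !addr0 subst_chain_delta ch_cons ch_nil addr0.
Qed.

(** * Weights of chains *)

Section Weight.
Variables (R : realType) (E : finType) (v : E -> R).
Hypothesis v0 : forall e, 0 < v e.
Implicit Types c d : {ffun E * bool -> bool}.

Definition wt c : R := \sum_(x | c x) v x.1.

Lemma wt_ge0 c : 0 <= wt c.
Proof. by apply: sumr_ge0 => x _; apply: ltW. Qed.

Lemma wt0 : wt 0 = 0.
Proof. by rewrite /wt big1 // => x; rewrite ffunE. Qed.

Lemma wt_gt0 c : c != 0 -> 0 < wt c.
Proof.
move=> c0; have [x cx] : exists x, c x.
  apply/existsP; apply: contraR c0; rewrite negb_exists => /forallP cx.
  by apply/eqP/ffunP=> x; rewrite ffunE; apply/negbTE/cx.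
rewrite /wt (bigD1 x) //= ltr_pwDl // sumr_ge0 // => y _; exact: ltW.
Qed.

Lemma wtD c d : wt (c + d) <= wt c + wt d.
Proof.
rewrite /wt !(big_mkcond (fun x => fun_of_fin _ x)) /= -big_split /=.
apply: ler_sum => x _; rewrite ffunE; have := ltW (v0 x.1).
by case: (c x) (d x) => [] [] /=; lra.
Qed.

Lemma wt_sum (I : Type) (r : seq I) (F : I -> {ffun E * bool -> bool}) :
  wt (\sum_(i <- r) F i) <= \sum_(i <- r) wt (F i).
Proof.
elim: r => [|i r IHr]; first by rewrite !big_nil wt0.
by rewrite !big_cons; apply: le_trans (wtD _ _) _; rewrite lerD2l.
Qed.

Lemma wt_delta x : wt (delta x) = v x.1.
Proof. by rewrite /wt (big_pred1 x) // => y; rewrite ffunE. Qed.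

Lemma wt_ch k s w : wt (ch k s w) <= len v w.
Proof.
apply: le_trans (wt_sum _ _) _; rewrite le_eqVlt; apply/orP; left; apply/eqP.
rewrite (eq_bigr (fun x => v x.1)) => [|x _]; last exact: wt_delta.
by rewrite -(big_map fst xpredT v) map_lifts big_map.
Qed.

Lemma wt_ch_uniq k s w : uniq (lifts k s w) -> wt (ch k s w) = len v w.
Proof.
move=> ul; rewrite /wt (eq_bigl (mem (lifts k s w))) => [|x]; last first.
  by rewrite ch_uniq // ffunE.
by rewrite -big_uniq //= -(big_map fst xpredT v) map_lifts big_map.
Qed.

End Weight.

Lemma wt_subst_chain (R : realType) (E L : finType) (v : L -> R)
    (k : L -> bool) (s : E -> seq (L * bool)) c : (forall e, 0 < v e) ->
  wt v (subst_chain k s c) <= wt (fun e => len v (s e)) c.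
Proof.
move=> v0; apply: le_trans (wt_sum v0 _ _) _.
rewrite /wt [leRHS]big_mkcond; apply: ler_sum => x _.
by case: (c x); [apply: wt_ch | rewrite -/(wt v 0) wt0].
Qed.

Lemma wt_push_chain (R : realType) (E L : finType) (v : L -> R) (phi : E -> L) c :
  (forall e, 0 < v e) -> wt v (push_chain phi c) <= wt (v \o phi) c.
Proof.
move=> v0; apply: le_trans (wt_subst_chain _ _ _ v0) _.
by rewrite /wt ler_sum // => x _; rewrite len_cons len_nil addr0.
Qed.

Lemma uniq_fst_inj (T1 T2 : eqType) (r : seq (T1 * T2)) x y z :
  uniq (map fst r) -> (x, y) \in r -> (x, z) \in r -> y = z.
Proof.
elim: r => //= -[a b] r IHr /andP[ar ur]; rewrite !inE !xpair_eqE.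
case/orP=> [/andP[/eqP ea /eqP->]|xr] /orP[/andP[/eqP ea' /eqP->]|xr'] //.
- by case/negP: ar; rewrite /= -ea; apply: (map_f fst xr').
- by case/negP: ar; rewrite /= -ea'; apply: (map_f fst xr).
exact: IHr.
Qed.

(** In the double cover in which b and d both have nontrivial holonomy, a
    dumbbell passes its bar once in each sheet. *)
Lemma dumbbell_lift (E : finType) (k : E -> bool) s (b u d : seq (E * bool)) :
  simple (b ++ u ++ d) -> hol k b -> hol k d ->
  hol k (b ++ u ++ d ++ invw u) = false /\ uniq (lifts k s (b ++ u ++ d ++ invw u)).
Proof.
move=> sw hb hd; rewrite !hol_cat hol_invw hb hd; split; first by case: hol.
rewrite !lifts_cat hb hd addbT lifts_invw !addbT addNb negbK addbK.
set B := lifts k s b; set U := lifts k (~~ s) u; set D := lifts _ _ d.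
have fU : map fst (rev (lifts k s u)) = rev (map fst u).
  by rewrite map_rev map_lifts.
move: sw; rewrite /simple !map_cat => sw.
have uU : uniq (map fst u) by move: sw; rewrite !cat_uniq => /and4P[_ _ ->].
have : uniq (map fst (B ++ U ++ D)) by rewrite !map_cat !map_lifts.
move/map_uniq => uBUD; rewrite catA catA cat_uniq -catA uBUD rev_uniq /=.
rewrite (map_uniq (f := fst)) ?map_lifts // andbT.
apply/hasPn=> -[e t]; rewrite mem_rev => eu /=.
have eu1 : e \in map fst u by rewrite -(map_lifts k s); apply: (map_f fst eu).
rewrite !mem_cat !negb_or; apply/and3P; split.
- apply: contraL sw => /(map_f fst); rewrite map_lifts /= => eb.
  by rewrite cat_uniq negb_and; apply/orP; right; rewrite negb_and negbK;
     apply/orP; left; apply/hasP; exists e; rewrite ?mem_cat ?eu1.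
- rewrite /U lifts_negb; apply/mapP=> -[[e' t'] eu' [ee tt']]; subst e' t.
  have : uniq (map fst (lifts k s u)) by rewrite map_lifts.
  move/uniq_fst_inj => /(_ _ _ _ eu eu') tt; by case: t' tt eu eu' => [] [].
- apply: contraL sw => /(map_f fst); rewrite map_lifts /= => eb.
  rewrite cat_uniq !negb_and cat_uniq !negb_and !negbK; apply/orP; right; apply/orP; right.
  by apply/orP; right; apply/orP; left; apply/hasP; exists e.
Qed.

Lemma two_holonomies (E : finType) (b u d : seq (E * bool)) :
  simple (b ++ u ++ d) -> b != [::] -> d != [::] ->
  exists k, hol k b /\ hol k d.
Proof.
case: b d => [|x b] // [|y d] // sw _ _; exists (fun e => (e == x.1) || (e == y.1)).
have h0 (k : E -> bool) w : {in map fst w, forall e, k e = false} -> hol k w = false.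
  elim: w => //= a w IHw kw; rewrite kw ?mem_head // IHw // => e ew.
  by rewrite kw // inE ew orbT.
move: sw; rewrite /simple /= !map_cat /= mem_cat mem_cat inE !negb_or.
case/andP=> /and4P[xb xu xy xd].
rewrite !cat_uniq /= !has_cat /= !negb_or => /and5P[_ /and3P[_ yb db] _ _ /andP[yd _]].
rewrite /= !eqxx orbT /=; split; rewrite h0 // => e ew; apply/negbTE; rewrite negb_or.
  by apply/andP; split; [apply: contraNneq xb => <- | apply: contraNneq yb => <-].
by apply/andP; split; [apply: contraNneq xd => <- | apply: contraNneq yd => <-].
Qed.

(** * Walks and loops in a graph *)

(** A graph is given by the origins of its oriented edges. *)
Section Walks.
Variables (X : choiceType) (V : eqType) (org : X * bool -> V).
Implicit Types (x y z : V) (a : X * bool) (w : seq (X * bool)).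

Fixpoint walk x w y :=
  if w is a :: w' then (org a == x) && walk (org (invl a)) w' y else x == y.

Definition closed_walk w := if w is a :: _ then walk (org a) w (org a) else true.

Definition step (a b : X * bool) := (org b == org (invl a)) && (b != invl a).

Lemma step_sym a b : step a b = step (invl b) (invl a).
Proof. by rewrite /step invlK eq_sym (eq_sym b). Qed.

Lemma walk_closed x w : walk x w x -> closed_walk w.
Proof. by case: w => //= a w; case/andP=> /eqP->; rewrite eqxx. Qed.

Lemma walk_cat x y z u w : walk x u y -> walk y w z -> walk x (u ++ w) z.
Proof.
elim: u x => [|a u IHu] x /=; first by move/eqP->.
by case/andP=> -> wu /(IHu _ wu).
Qed.

Lemma walk_split x z u w : walk x (u ++ w) z -> exists2 y, walk x u y & walk y w z.
Proof.
elim: u x => [|a u IHu] x /=; first by exists x.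
by case/andP=> -> /IHu.
Qed.

Lemma walk_invw x w y : walk x w y -> walk y (invw w) x.
Proof.
elim: w x => [|a w IHw] x /=; first by rewrite eq_sym.
case/andP=> /eqP<- /IHw ww; rewrite invw_cons -cats1; apply: walk_cat ww _.
by rewrite /= invlK !eqxx.
Qed.

Lemma walk_end x w y y' : walk x w y -> walk x w y' -> y = y'.
Proof.
elim: w x => [|a w IHw] x /=; first by move=> /eqP<- /eqP.
by case/andP=> _ wy /andP[_]; apply: IHw.
Qed.

Lemma walk_start x x' w y y' : w != [::] -> walk x w y -> walk x' w y' -> x = x'.
Proof. by case: w => //= a w _ /andP[/eqP<- _] /andP[/eqP<-]. Qed.

Lemma path_walk a w b : path step a (rcons w b) -> walk (org a) (a :: w) (org b).
Proof.
elim: w a => [|c w IHw] a /=; first by rewrite !andbT eqxx eq_sym => /andP[].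
by case/andP=> /andP[/eqP ac _] /IHw /= /andP[_ ww]; rewrite -ac !eqxx.
Qed.

Lemma cycle_closed w : cycle step w -> closed_walk w.
Proof. by case: w => // a w /path_walk. Qed.

Lemma cycle_reduced w : cycle step w -> cycle (@reduced_step X) w.
Proof. by case: w => // a w; apply: sub_path => x y /andP[]. Qed.

(** The bar of a closed dumbbell ends where its reverse starts, so both ends of
    the dumbbell close up. *)
Lemma dumbbell_closed b u d : u != [::] -> closed_walk (b ++ u ++ d ++ invw u) ->
  closed_walk b /\ closed_walk d.
Proof.
move=> un cw; have [x] : exists x, walk x (b ++ u ++ d ++ invw u) x.
  have : b ++ u ++ d ++ invw u != [::] by case: b {cw} => //; case: u un.
  by case: (b ++ _) cw => // a w ww _; exists (org a).
case/walk_split=> y wb /walk_split[z wu /walk_split[t wd wu']].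
have iun : invw u != [::] by rewrite -size_eq0 size_invw size_eq0.
have zt := walk_start iun (walk_invw wu) wu'.
have yx : y = x by apply: walk_end (walk_invw wu) _; rewrite zt.
by split; [apply: (@walk_closed x); rewrite -{2}yx
          | apply: (@walk_closed z); rewrite {2}zt].
Qed.

Lemma dumbbell_neq0 b u d : u != [::] -> cycle step (b ++ u ++ d ++ invw u) ->
  b != [::] /\ d != [::].
Proof.
move=> un cw; split; apply: contraTneq cw => ->.
  case: u un => // x u _; rewrite invw_cons -cats1 !catA cycle_catC /=.
  by rewrite /step invlK !eqxx.
case/lastP: u un => // u x _; rewrite /invw map_rcons rev_rcons /= -cats1 -catA catA.
by rewrite cycle_catC /= /step !eqxx.
Qed.

End Walks.

(** * Folding two edges *)

Lemma bool_neq (b c : bool) : b != c -> b = ~~ c.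
Proof. by case: b c => [] []. Qed.

Section FoldStep.
Variables (E E' : finType) (V V' : eqType).
Variables (org : E * bool -> V) (org' : E' * bool -> V').
Variables (phi : E -> E') (r : V -> V') (ea eb : E) (s0 : bool).

(** The edges ea and eb leave the same vertex in the direction s0 and have
    distinct ends; phi and r identify exactly these edges and these ends. *)
Hypothesis org_ab : org (ea, s0) = org (eb, s0).
Hypothesis end_ab : org (ea, ~~ s0) <> org (eb, ~~ s0).
Hypothesis org_phi : forall a, org' (relabel phi a) = r (org a).
Hypothesis phi_ab : phi ea = phi eb.
Hypothesis phi_eq : forall e e', phi e = phi e' ->
  [\/ e = e', e = ea /\ e' = eb | e = eb /\ e' = ea].
Hypothesis r_eq : forall x y, r x = r y -> [\/ x = y,
  x = org (ea, ~~ s0) /\ y = org (eb, ~~ s0) |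
  x = org (eb, ~~ s0) /\ y = org (ea, ~~ s0)].
Hypothesis phi_surj : forall e', exists e, phi e = e'.

Local Notation lphi := (map (relabel phi)).

Lemma r_ends : r (org (ea, ~~ s0)) = r (org (eb, ~~ s0)).
Proof. by rewrite -!org_phi /relabel /= phi_ab. Qed.

Lemma lift_vertex x y : r x = r y ->
  exists2 w, walk org x w y & redword (lphi w) = 1%g.
Proof.
have c2 a b s : phi a = phi b ->
    redword (lphi [:: (a, ~~ s); (b, s)]) = 1%g :> freegroup E'.
  move=> ab; rewrite /= /relabel /= ab -{2}[s]negbK.
  exact: (cancel_pair [::] (phi b, ~~ s) [::]).
case/r_eq=> [->|[-> ->]|[-> ->]]; first by exists [::] => //=.
  by exists [:: (ea, ~~ s0); (eb, s0)]; rewrite ?c2 //= /invl /= negbK org_ab !eqxx.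
by exists [:: (eb, ~~ s0); (ea, s0)]; rewrite ?c2 //= /invl /= negbK org_ab !eqxx.
Qed.

(** A path in the folded graph lifts once the gaps between the two identified
    ends are bridged by ea^-1 eb or its inverse, which the fold cancels. *)
Lemma lift_walk x w' y : walk org' (r x) w' (r y) ->
  exists2 w, walk org x w y & redword (lphi w) = redword w'.
Proof.
elim: w' x => [|[e' s] w' IHw] x /=; first by move/eqP/lift_vertex.
have [e <-] := phi_surj e'; rewrite -[(phi e, s)]/(relabel phi (e, s)).
rewrite -[invl _]/(relabel phi (invl (e, s))) !org_phi => /andP[/eqP ex /IHw[w ww ew]].
have [u wu eu] := lift_vertex (esym ex).
exists (u ++ (e, s) :: w); first by apply: walk_cat wu _; rewrite /= eqxx.
by rewrite map_cat redword_cat eu mul1g /= -cat1s redword_cat ew -redword_cat.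
Qed.

Lemma lift_closed w' : closed_walk org' w' ->
  exists2 w, closed_walk org w & redword (lphi w) = redword w'.
Proof.
case: w' => [|[e' s] w']; first by exists [::].
have [e <-] := phi_surj e'; rewrite /closed_walk -[(phi e, s)]/(relabel phi (e, s)) org_phi.
by case/lift_walk=> w /walk_closed cw ew; exists w.
Qed.

Definition turn (p q : E * bool) :=
  [&& p.2 == ~~ s0, q.2 == s0 &
      (p.1 == ea) && (q.1 == eb) || (p.1 == eb) && (q.1 == ea)].

Lemma turn_invl p q : turn p q = turn (invl q) (invl p).
Proof.
case: p q => [e s] [e' s']; rewrite /turn /= (inj_eq negb_inj) eqb_negLR.
by rewrite andbCA; congr [&& _, _ & _]; rewrite orbC; congr (_ || _); rewrite andbC.
Qed.

Lemma turnE p q : turn p q ->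
  (p = (ea, ~~ s0) /\ q = (eb, s0)) \/ (p = (eb, ~~ s0) /\ q = (ea, s0)).
Proof.
case: p q => [e s] [e' s']; rewrite /turn /=.
by case/and3P=> /eqP-> /eqP-> /orP[/andP[/eqP-> /eqP->]|/andP[/eqP-> /eqP->]]; auto.
Qed.

Lemma turn_turn p q t : turn p q -> turn q t = false.
Proof. by case/and3P=> _ /eqP qs _; rewrite /turn qs; case: s0. Qed.

Lemma turn_step_turn p q t z :
  turn p q -> step org q t -> turn t z -> False.
Proof.
move=> tt /andP[/eqP oq /eqP nq] tt'.
move: oq nq; case: (turnE tt) => -[_ ->]; case: (turnE tt') => -[-> _];
  rewrite /invl //=; by [move/end_ab | move/esym/end_ab].
Qed.

Lemma step_phi p q : step org p q -> ~~ turn p q ->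
  step org' (relabel phi p) (relabel phi q).
Proof.
case: p q => [e s] [e' s'] /andP[/eqP eo np] nt; apply/andP; split.
  by rewrite -[invl _]/(relabel phi (invl (e, s))) !org_phi eo.
apply/eqP=> -[/phi_eq ee ss]; subst s'.
case: ee => [ee|[ee1 ee2]|[ee1 ee2]]; first by rewrite ee /invl /= eqxx in np.
  have [ss|ss] := eqVneq s s0.
    by move: eo; rewrite ee1 ee2 ss /invl /= => /end_ab.
  by case/negP: nt; rewrite /turn /= ee1 ee2 (bool_neq ss) negbK !eqxx orbT.
have [ss|ss] := eqVneq s s0.
  by move: eo; rewrite ee1 ee2 ss /invl /= => /esym/end_ab.
by case/negP: nt; rewrite /turn /= ee1 ee2 (bool_neq ss) negbK !eqxx.
Qed.

Lemma step_phi_turn p q t z : step org p q -> turn q t -> step org t z ->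
  step org' (relabel phi p) (relabel phi z).
Proof.
case: p z => [e s] [e' s'] st1 tt st2; apply/andP; split.
  rewrite -[invl _]/(relabel phi (invl (e, s))) !org_phi.
  case/andP: st1 => /eqP<- _; case/andP: st2 => /eqP-> _.
  by case: (turnE tt) => -[-> ->]; rewrite /invl /= r_ends.
apply/eqP=> -[/phi_eq ee ss]; subst s'.
have o1 : org (invl t) <> org q.
  by case: (turnE tt) => -[-> ->]; rewrite /invl /=; [move/esym|]; apply: end_ab.
case/andP: st1 => /eqP oq nq; case/andP: st2 => /eqP oz nz.
have o2 : org (e', ~~ s) <> org (e, ~~ s).
  by rewrite oz -[(e, ~~ s)]/(invl (e, s)) -oq.
case: ee => [ee|[ee1 ee2]|[ee1 ee2]]; first by rewrite ee in o2.
  subst e e'; have [ss|ss] := eqVneq s (~~ s0).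
    by move: o2; rewrite ss negbK org_ab.
  have {}ss : s = s0 by rewrite (bool_neq ss) negbK.
  by subst s; case: (turnE tt) nq oq => -[-> _]; rewrite /invl /= ?eqxx // => _ /end_ab.
subst e e'; have [ss|ss] := eqVneq s (~~ s0).
  by move: o2; rewrite ss negbK org_ab.
have {}ss : s = s0 by rewrite (bool_neq ss) negbK.
by subst s; case: (turnE tt) nq oq => -[-> _]; rewrite /invl /= ?eqxx // => _ /esym/end_ab.
Qed.

(** Removes the folded turns, whose two letters cancel in the folded graph. *)
Fixpoint del w := if w is p :: w1 then
    if w1 is q :: w2 then if turn p q then del w2 else p :: del w1 else [:: p]
  else [::].

Arguments del : simpl never.

Lemma del1 p : del [:: p] = [:: p]. Proof. by []. Qed.

Lemma del_cons p q w :
  del [:: p, q & w] = if turn p q then del w else p :: del (q :: w).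
Proof. by []. Qed.

Lemma del_ind (P : E * bool -> seq (E * bool) -> Prop) :
  (forall x, P x [::]) -> (forall x p, ~~ turn x p -> P x [:: p]) ->
  (forall x p q w, ~~ turn x p -> ~~ turn p q -> P p (q :: w) -> P x (p :: q :: w)) ->
  (forall x p q w, ~~ turn x p -> turn p q -> (~~ turn q (head q w)) -> P q w ->
    P x (p :: q :: w)) ->
  forall x w, ~~ turn x (head x w) -> P x w.
Proof.
have txx x : turn x x = false by rewrite /turn; case: (x.2) s0 => [] [].
move=> P0 P1 P2 P3 x w; have [k] := ubnP (size w); elim: k x w => // k IHk x.
case=> [|p [|q w]] //= /ltnSE wk nt; first exact: P1.
have [tpq|npq] := boolP (turn p q); last by apply: P2 => //; apply: IHk.
have nq : ~~ turn q (head q w).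
  by case: w {wk} => [|t w] /=; rewrite ?txx ?(turn_turn _ tpq).
by apply: P3 => //; apply: IHk => //; apply: ltnW.
Qed.

(** What remains is tight in the folded graph: across a removed turn, the
    letters on both sides leave the distinct ends of ea and eb, so they are
    not identified. *)
Lemma path_del x w : ~~ turn x (head x w) -> path (step org) x w ->
  path (step org') (relabel phi x) (lphi (del w)).
Proof.
have [k] := ubnP (size w); elim: k x w => // k IHk x.
case=> [|p [|q w]] // /ltnSE wk /= nt; first by rewrite !andbT => /step_phi->.
rewrite del_cons; case: ifP => [tpq|/negbT ntpq] /and3P[xp pq qw]; last first.
  by rewrite /= step_phi //= IHk //= pq.
case: w {nt} wk qw => [|t [|z w]] wk //.
  by rewrite del1 /= !andbT => /(step_phi_turn xp tpq).
case/and3P=> qt tz zw; rewrite del_cons; case: ifP => [ttz|/negbT ntz].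
  by case: (turn_step_turn tpq qt ttz).
rewrite /= (step_phi_turn xp tpq qt) IHk //= ?tz //.
by apply: leq_trans wk; rewrite /= ltnS ltnW.
Qed.

Lemma redword_del w : redword (lphi (del w)) = redword (lphi w).
Proof.
have [k] := ubnP (size w); elim: k w => // k IHk.
case=> [|p [|q w]] // /ltnSE wk; rewrite del_cons; case: ifP => [/turnE tpq|_].
  have e : redword (lphi [:: p; q]) = 1%g :> freegroup E'.
    have -> : lphi [:: p; q] = [:: relabel phi p; invl (relabel phi p)].
      by case: tpq => -[-> ->]; rewrite /relabel /invl /= negbK phi_ab.
    exact: (cancel_pair [::] _ [::]).
  by rewrite (IHk _ (ltnW wk)) -[[:: p, q & w]]/([:: p; q] ++ w) map_cat redword_cat e mul1g.
by rewrite -[p :: del _]cat1s -[[:: p, q & w]]cat1s !map_cat !redword_cat (IHk (q :: w) wk).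
Qed.

Lemma del_rcons w x : ~~ turn (last x w) x -> del (rcons w x) = rcons (del w) x.
Proof.
have [k] := ubnP (size w); elim: k w => // k IHk.
case=> [|p [|q w]] // /ltnSE wk nt; first by rewrite del_cons (negPf nt).
rewrite !rcons_cons !del_cons; case: ifP => _; last by rewrite -rcons_cons IHk.
apply: IHk; first exact: ltnW.
by case: w nt {wk} => //= _; rewrite /turn; case: (x.2) s0 => [] [].
Qed.

Section TurnLoss.
Variables (R : realType) (v : E -> R).

(** What a fold takes from the length of a loop: both sides of each turn
    that it takes. *)
Definition turn_loss (p q : E * bool) : R := if turn p q then v p.1 + v q.1 else 0.

Lemma turn_loss_sym : turn_sym turn_loss.
Proof. by move=> p q; rewrite /turn_loss turn_invl addrC. Qed.

Lemma len_del x w : ~~ turn x (head x w) ->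
  len v (del w) = len v w - psum turn_loss x w.
Proof.
move: x w; apply: del_ind => [x|x p nt|x p q w nt npq|x p q w nt tpq nq].
- by rewrite subr0.
- by rewrite del1 /= /turn_loss (negPf nt) !addr0 subr0.
- rewrite del_cons (negPf npq) !len_cons => ->; rewrite /= [turn_loss x p]/turn_loss (negPf nt).
  by rewrite /=; ring.
rewrite del_cons tpq => ->; rewrite !len_cons /= [turn_loss x p]/turn_loss (negPf nt).
by rewrite [turn_loss p q]/turn_loss tpq; ring.
Qed.

End TurnLoss.

(** Two turns of a loop neither overlap nor follow each other immediately, so some
    letter lies in no turn. *)
Lemma rot_turnless w : w != [::] -> cycle (step org) w ->
  exists x w', [/\ (exists k, x :: w' = rot k w), ~~ turn x (head x w')
                 & ~~ turn (last x w') x].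
Proof.
have txx x : turn x x = false by rewrite /turn; case: (x.2) s0 => [] [].
case: w => // x w _ cw.
have [t1|nt1] := boolP (turn (last x w) x).
  case: w t1 cw => [|y w] /= t1; first by rewrite txx in t1.
  case/andP=> xy pw; exists y, (rcons w x); split.
  - by exists 1%N; rewrite rot1_cons.
  - by apply/negP; apply: turn_step_turn t1 xy.
  - by rewrite last_rcons (turn_turn _ t1).
have [t2|nt2] := boolP (turn x (head x w)); last first.
  by exists x, w; split=> //; exists 0%N; rewrite rot0.
case: w t2 cw nt1 => [|y [|z w]] /= t2; first by rewrite txx in t2.
  by case/and3P=> _ yx _; case: (turn_step_turn t2 yx t2).
case/and3P=> xy yz pw _; exists z, (w ++ [:: x; y]); split.
- by exists 2%N.
- by apply/negP; apply: turn_step_turn t2 yz.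
- by rewrite last_cat /= (turn_turn _ t2).
Qed.

(** Folding a loop shortens it exactly by the length of the turns that are
    folded: removing them creates no new cancellation. *)
Lemma fold_loop (R : realType) (v : E' -> R) w : cycle (step org) w ->
  exists w', [/\ cycle (step org') w', conjw w' (lphi w)
    & len v w' = len (v \o phi) w - csum (turn_loss (v \o phi)) w].
Proof.
have [-> _|wn cw] := eqVneq w [::].
  by exists [::]; split=> //; [apply: conjw_refl | rewrite !len_nil subr0].
have [x [w1 [[k ew] nt1 nt2]]] := rot_turnless wn cw.
have nt3 : ~~ turn x (head x (rcons w1 x)) by case: (w1) nt1.
have cw1 : path (step org) x (rcons w1 x).
  by rewrite -[path _ _ _]/(cycle (step org) (x :: w1)) ew rot_cycle.
exists (lphi (x :: del w1)); split.
- by have := path_del nt3 cw1; rewrite del_rcons // map_rcons.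
- apply: conjw_trans (conjw_relabel phi (conjw_rot k w)); rewrite -ew.
  apply: conjw_redword; rewrite -[x :: del w1]cat1s -[x :: w1]cat1s !map_cat.
  by rewrite !redword_cat redword_del.
have := len_del (v \o phi) nt3; rewrite del_rcons // !len_rcons.
rewrite -[psum _ _ _]/(csum (turn_loss (v \o phi)) (x :: w1)) ew csum_rot.
have -> : len (v \o phi) w = len (v \o phi) (x :: w1).
  by rewrite ew /rot len_catC cat_take_drop.
by rewrite len_relabel !len_cons; lra.
Qed.

End FoldStep.

(** * The potential along a sequence of folds *)

Section Folding.
Variables (R : realType) (L : finType) (v : L -> R) (I J : finType).
Variables (xi : I -> L -> bool) (D : pred J).
Hypothesis v0 : forall e, 0 < v e.

(** The graph with edges E maps to a rose with petals L. The chains c j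
    include every nonzero cycle that a closed path traces in one of the double
    covers that the cochains xi i define, none of them is killed by the map,
    and every double cover of the graph is isomorphic to one of these: a
    cochain matters only through its holonomies around closed paths. *)
Record cover_family (E : finType) (V : eqType) (org : E * bool -> V) (lab : E -> L)
    (c : J -> {ffun E * bool -> bool}) : Prop := CoverFamily {
  family_cycle : forall i s w, closed_walk org w -> hol (xi i \o lab) w = false ->
    ch (xi i \o lab) s w != 0 -> exists2 j, D j & c j = ch (xi i \o lab) s w;
  family_push : forall j, D j -> push_chain lab (c j) != 0;
  family_cochain : forall k : E -> bool, exists i, forall w, closed_walk org w ->
    hol k w = hol (xi i \o lab) w
}.

(** An extremal candidate lifts to a double cover as a cycle that repeats no
    edge, so its weight is the length of the candidate. *)
Lemma candidate_cycle (E : finType) (V : eqType) (org : E * bool -> V)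
    (lab : E -> L) c w :
  cover_family org lab c -> cycle (step org) w -> w != [::] -> candidate w ->
  exists i j, [/\ D j, hol (xi i \o lab) w = false,
    c j = ch (xi i \o lab) false w
  & wt (v \o lab) (c j) = len (v \o lab) w].
Proof.
move=> cf cw wn candw; have clw := cycle_closed cw.
have vl0 e : 0 < (v \o lab) e by apply: v0.
have [i [hw ul]] : exists i, hol (xi i \o lab) w = false /\
    uniq (lifts (xi i \o lab) false w).
  case: candw => [sw|[b [u [d [ew un sw]]]]].
    have [i iP] := family_cochain cf (fun=> false); exists i; rewrite -iP //.
    split; first by elim: (w).
    by apply: (@map_uniq _ _ fst); rewrite map_lifts.
  rewrite ew in cw clw.
  have [bn dn] := dumbbell_neq0 un cw; have [cb cd] := dumbbell_closed un clw.
  have [k [kb kd]] := two_holonomies sw bn dn.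
  have [i iP] := family_cochain cf k; exists i; rewrite ew.
  by apply: dumbbell_lift => //; rewrite -iP.
have wE := wt_ch_uniq (v \o lab) ul.
have w_gt0 : 0 < len (v \o lab) w.
  by case: (w) wn => // a w' _; rewrite len_cons ltr_pwDl // len_ge0 // => e; apply: ltW.
have cn : ch (xi i \o lab) false w != 0.
  by apply: contraTneq w_gt0 => c0; rewrite -wE c0 wt0 ltxx.
have [j Dj cj] := family_cycle cf clw hw cn.
by exists i, j; rewrite cj wE.
Qed.

Lemma ler_prod_drop (P : pred J) (A B : J -> R) (t : R) j0 : P j0 ->
  (forall j, P j -> 0 <= B j <= A j) -> B j0 <= t * A j0 ->
  \prod_(j | P j) B j <= t * \prod_(j | P j) A j.
Proof.
move=> Pj0 BA Bt; rewrite !(bigD1 j0 Pj0) /= mulrA.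
have [B0 _] := andP (BA _ Pj0); apply: ler_pM => //.
  by apply: prodr_ge0 => j /andP[/BA /andP[]].
by apply: ler_prod => j /andP[/BA].
Qed.

(** Fold two edges whose turn maximises the ratio of folded length to length.
    Every loop loses at most the proportion theta of its length, while some
    chain in the family loses at least this proportion, and no chain gets
    heavier. When nothing can be folded, loops keep their length and the map
    to the rose can only decrease weights. *)
Theorem folding_inequality (E : finType) (V : eqType) (org : E * bool -> V)
    (lab : E -> L) c (a : seq (E * bool)) :
  cover_family org lab c -> cycle (step org) a ->
  exists b, [/\ cycle (@reduced_step L) b, conjw b (map (relabel lab) a)
  & len (v \o lab) a * \prod_(j | D j) wt v (push_chain lab (c j)) <=
    len v b * \prod_(j | D j) wt (v \o lab) (c j)].
Proof.
have [m] := ubnP #|E|; elim: m => // m IHm in E V org lab c a * => /ltnSE Em cf ca.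
have vl0 e : 0 < (v \o lab) e by apply: v0.
have [->|an] := eqVneq a [::].
  by exists [::]; rewrite !len_nil !mul0r; split=> //; apply: conjw_refl.
have [/existsP[ea /existsP[eb /existsP[s0 /and3P[nab /eqP oab /eqP lab_ab]]]]|nfold] :=
  boolP [exists ea, exists eb, exists s0, [&& ea != eb,
    org (ea, s0) == org (eb, s0) & lab ea == lab eb]]; last first.
  exists (map (relabel lab) a); split; last 1 first.
  - rewrite len_relabel ler_wpM2l ?len_ge0 // => [e|]; first exact: ltW.
    by apply: ler_prod => j _; rewrite wt_ge0 //= wt_push_chain.
  - case: a an ca => // x w _ /=; rewrite -map_rcons path_map.
    apply: sub_path => -[e s] [e' s'] /andP[/eqP oe ne].
    rewrite /reduced_step /=; apply: contraNneq ne => -[le ss]; subst s'.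
    apply: contraR nfold => ne; apply/existsP; exists e'; apply/existsP; exists e.
    apply/existsP; exists (~~ s); rewrite oe le !eqxx !andbT.
    by apply: contraNneq ne => ->.
  - exact: conjw_refl.
(* equal ends would give a cycle that the map kills *)
have end_ab : org (ea, ~~ s0) <> org (eb, ~~ s0).
  move=> eo; pose w := [:: (ea, ~~ s0); (eb, s0)].
  have cw : closed_walk org w by rewrite /= /invl /= negbK oab eo !eqxx.
  have [i _] := family_cochain cf (fun=> false).
  have hw : hol (xi i \o lab) w = false by rewrite /= lab_ab addbF addbb.
  have cn : ch (xi i \o lab) false w != 0.
    rewrite ch_uniq; last by rewrite /= inE xpair_eqE negb_and nab.
    by apply/eqP=> /ffunP/(_ (lift1 (xi i \o lab) false (ea, ~~ s0))); rewrite !ffunE mem_head.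
  have [j Dj cj] := family_cycle cf cw hw cn.
  have /eqP[] := family_push cf Dj; rewrite cj push_ch.
  have -> : map (relabel lab) w = [:: (lab eb, ~~ s0); invl (lab eb, ~~ s0)].
    by rewrite /= /relabel /invl /= lab_ab negbK.
  by rewrite (ch_redword _ _ (cancel_pair [::] _ [::])) ch_nil.
(* the folded graph: eb is removed and its end is moved to the end of ea *)
pose E' : finType := {e : E | e != eb}.
pose phi e : E' := insubd (exist _ ea nab) e.
have val_phi e : val (phi e) = if e != eb then e else ea by rewrite val_insubd.
pose r x := if x == org (eb, ~~ s0) then org (ea, ~~ s0) else x.
pose org' (a : E' * bool) := r (org (val a.1, a.2)).
have org_phi x : org' (relabel phi x) = r (org x).
  case: x => e s; rewrite /org' /relabel /= val_phi.
  case: eqVneq => [->|//]; case: (eqVneq s s0) => [->|/bool_neq ->]; first by rewrite oab.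
  by rewrite /r eqxx; case: eqP.
have phi_ab : phi ea = phi eb by apply: val_inj; rewrite !val_phi eqxx nab.
have phi_eq e e' : phi e = phi e' ->
    [\/ e = e', e = ea /\ e' = eb | e = eb /\ e' = ea].
  move/(congr1 val); rewrite !val_phi.
  case: eqVneq => [->|_]; case: eqVneq => [->|_] /= ee.
  - by constructor 1.
  - by constructor 3.
  - by constructor 2.
  - by constructor 1.
have r_eq x y : r x = r y -> [\/ x = y,
    x = org (ea, ~~ s0) /\ y = org (eb, ~~ s0) |
    x = org (eb, ~~ s0) /\ y = org (ea, ~~ s0)].
  rewrite /r; case: eqP => [->|_]; case: eqP => [->|_] ee.
  - by constructor 1.
  - by constructor 3.
  - by constructor 2.
  - by constructor 1.
have phi_surj e' : exists e, phi e = e'.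
  by exists (val e'); apply: val_inj; rewrite val_phi (valP e').
pose lab' (e : E') := lab (val e).
have lab'_phi e : lab' (phi e) = lab e.
  by rewrite /lab' val_phi; case: eqVneq => //= ->.
have lab'_comp : lab' \o phi = lab by apply/funext.
pose c' j := push_chain phi (c j).
have liftC := lift_closed oab org_phi phi_ab r_eq phi_surj.
have lab_phi w : map (relabel lab') (map (relabel phi) w) = map (relabel lab) w.
  by rewrite -map_comp; apply: eq_map => -[e s]; rewrite /relabel /= lab'_phi.
have hol_phi i w : hol (xi i \o lab') (map (relabel phi) w) = hol (xi i \o lab) w.
  by rewrite hol_relabel; apply: eq_hol => e /=; rewrite lab'_phi.
have push_phi i s w :
    push_chain phi (ch (xi i \o lab) s w) = ch (xi i \o lab') s (map (relabel phi) w).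
  by rewrite -push_ch; congr push_chain; apply: eq_ch => e /=; rewrite lab'_phi.
have cf' : cover_family org' lab' c'.
  split.
  - move=> i s w' /liftC[w cw /esym ew]; rewrite (hol_redword _ ew) (ch_redword _ _ ew).
    rewrite hol_phi -push_phi => hw cn.
    have [|j Dj cj] := family_cycle cf (s := s) cw hw.
      by apply: contraNneq cn => ->; rewrite push_chain0.
    by exists j => //; rewrite /c' cj.
  - by move=> j Dj; rewrite push_chain_comp lab'_comp; apply: family_push cf _ Dj.
  - move=> k; have [i iP] := family_cochain cf (k \o phi); exists i.
    move=> w' /liftC[w cw /esym ew]; rewrite !(hol_redword _ ew) hol_phi -iP //.
    exact: hol_relabel.
pose g := turn_loss ea eb s0 (v \o lab).
pose h (x y : E * bool) := (v (lab x.1) + v (lab y.1)) / 2.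
have csum_h w : csum h w = len (v \o lab) w.
  case: w => [|x w]; first by rewrite len_nil.
  have H s : psum h x s = v (lab x.1) / 2 + len (v \o lab) s - v (lab (last x s).1) / 2.
    elim: s x => [|y s IHs] x'; first by rewrite len_nil /=; lra.
    by rewrite /= IHs len_cons /h /=; lra.
  by rewrite /= H last_rcons len_rcons len_cons /=; lra.
have [] := extremal_candidate (step_sym org) (g := g) (h := h) _ _ _ an ca.
- exact: turn_loss_sym.
- by move=> x y; rewrite /h addrC.
- by move=> x y; rewrite /h divr_gt0 // addr_gt0.
move=> th [thmax [w [wn cw gw candw]]].
have vE : v \o lab' \o phi = v \o lab by apply/funext=> e /=; rewrite lab'_phi.
have fold u := fold_loop oab end_ab org_phi phi_ab phi_eq (v \o lab') (w := u).
have vl'0 e : 0 < (v \o lab') e by apply: v0.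
have c'_le j : wt (v \o lab') (c' j) <= wt (v \o lab) (c j).
  by rewrite -vE; apply: wt_push_chain.
have [i [j [Dj hw cj wj]]] := candidate_cycle cf cw wn candw.
have c'j : wt (v \o lab') (c' j) <= (1 - th) * wt (v \o lab) (c j).
  have [w' [_ cw' lw']] := fold _ cw.
  have hw' : hol (xi i \o lab') w' = false by rewrite (hol_conjw _ cw') hol_phi.
  rewrite /c' {1}cj push_phi; have [s' ->] := ch_conjw false (conjw_sym cw') hw'.
  apply: le_trans (wt_ch vl'0 _ _ _) _; rewrite lw' vE -/g gw csum_h wj.
  by rewrite mulrBl mul1r.
have prodP : \prod_(j | D j) wt (v \o lab') (c' j) <=
    (1 - th) * \prod_(j | D j) wt (v \o lab) (c j).
  by apply: (ler_prod_drop Dj) => // j' _; rewrite wt_ge0 //= c'_le.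
have [a' [ca' aa' la']] := fold _ ca.
have Em' : (#|E'| < m)%N.
  have Ep : (0 < #|E|)%N by apply/card_gt0P; exists ea.
  have E1 : #|[pred e | e != eb]| = #|E|.-1 := cardC1 eb.
  by rewrite card_sig E1 prednK.
have [b [cb ab lb]] := IHm _ _ _ _ _ _ Em' cf' ca'.
exists b; split=> //.
  by apply: conjw_trans ab _; rewrite -lab_phi; apply: conjw_relabel.
have a'_ge : (1 - th) * len (v \o lab) a <= len (v \o lab') a'.
  by rewrite la' vE -/g mulrBl mul1r lerD2l lerN2 -csum_h; apply: thmax.
have pc : \prod_(j | D j) wt v (push_chain lab' (c' j)) =
          \prod_(j | D j) wt v (push_chain lab (c j)).
  by apply: eq_bigr => j' _; rewrite push_chain_comp lab'_comp.
rewrite {}pc in lb.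
set Q := \prod_(j | D j) wt v _ in lb *.
set P' := \prod_(j | D j) wt (v \o lab') _ in lb prodP.
set P := \prod_(j | D j) wt (v \o lab) _ in prodP *.
have P'0 : 0 < P'.
  apply: prodr_gt0 => j' Dj'; apply: wt_gt0 => //.
  apply: contraTneq (family_push cf' Dj') => ->.
  by rewrite push_chain0 eqxx.
have Q0 : 0 <= Q by apply: prodr_ge0 => j' _; apply: wt_ge0.
have P0 : 0 <= P by apply: prodr_ge0 => j' _; apply: wt_ge0.
have la0 : 0 <= len (v \o lab) a by apply: len_ge0 => e; apply: ltW.
rewrite -(ler_pM2r P'0).
apply: (@le_trans _ _ (len (v \o lab') a' * Q * P)).
  apply: (@le_trans _ _ ((1 - th) * len (v \o lab) a * Q * P)).
    have -> : (1 - th) * len (v \o lab) a * Q * P =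
        len (v \o lab) a * Q * ((1 - th) * P) by ring.
    by rewrite ler_wpM2l // mulr_ge0.
  by rewrite !ler_wpM2r.
by rewrite [leRHS]mulrAC ler_wpM2r.
Qed.

End Folding.

(** * Subdividing a graph along a graph map *)

Lemma path_flatten (A T : Type) (st : rel A) (e : rel T) (F : A -> seq T) a w b t :
  (forall a, F a <> [::]) -> (forall a, sorted e (F a)) ->
  (forall a b x y p q, st a b -> F a = rcons p x -> F b = y :: q -> e x y) ->
  path st a (rcons w b) ->
  path e (last t (F a)) (rcons (flatten (map F w)) (head t (F b))).
Proof.
move=> F0 Fs Fe; elim: w a => [|c w IHw] a /=.
  rewrite !andbT => ab; case/lastP Ea: (F a) (F0 a) => [//|p x] _.
  case Eb: (F b) (F0 b) => [//|y q] _.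
  by rewrite last_rcons (Fe a b x y p q).
case/andP=> ac /IHw; case/lastP Ea: (F a) (F0 a) => [//|p x] _.
case Ec: (F c) (F0 c) (Fs c) => [//|y q] _ sc.
by rewrite last_rcons rcons_cat /= (Fe a c x y p q) // cat_path /= => ->; rewrite andbT.
Qed.

(** Tightness of a concatenation of tight blocks is checked at the joints. *)
Lemma cycle_flatten (A T : Type) (st : rel A) (e : rel T) (F : A -> seq T) w :
  (forall a, F a <> [::]) -> (forall a, sorted e (F a)) ->
  (forall a b x y p q, st a b -> F a = rcons p x -> F b = y :: q -> e x y) ->
  cycle st w -> cycle e (flatten (map F w)).
Proof.
move=> F0 Fs Fe; case: w => // a w pw /=.
case Ea: (F a) (F0 a) (Fs a) => [//|y q] _ sa.
have := path_flatten y F0 Fs Fe pw; rewrite Ea /= => H.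
by rewrite rcons_cat cat_path H andbT.
Qed.

Lemma sorted_invw (X : choiceType) (V : eqType) (org : X * bool -> V) w :
  sorted (step org) w -> sorted (step org) (invw w).
Proof.
rewrite /invw rev_sorted sorted_map; apply: sub_sorted => a b /=.
by rewrite -step_sym.
Qed.

Section Subdivision.
Variables (G : graph) (f : graph_map G).

Definition sub_edge : finType := {e : edge G & 'I_(size (emap f e))}.

Definition sub_vertex : eqType := (vertex G + edge G * nat)%type.

Implicit Types (e : edge G) (x : sub_edge) (a : sub_edge * bool).

(** The i-th point on the image path of e, pulled back to e. *)
Definition sub_pt e (i : nat) : sub_vertex :=
  if i == 0 then inl (src e) else
  if i == size (emap f e) then inl (tgt e) else inr (e, i).

Definition sub_letter x := tnth (in_tuple (emap f (tag x))) (tagged x).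

Definition sub_lab x := (sub_letter x).1.

(** The edges of the subdivision are oriented by their labels, which may be
    against the edge of G that contains them. *)
Definition sub_dir a := a.2 == (sub_letter a.1).2.

Definition sub_org a : sub_vertex :=
  sub_pt (tag a.1) (if sub_dir a then tagged a.1 : nat else (tagged a.1).+1).

Definition sub_fwd e (i : 'I_(size (emap f e))) : sub_edge * bool :=
  (Tagged (fun e => 'I_(size (emap f e))) i,
   (sub_letter (Tagged (fun e => 'I_(size (emap f e))) i)).2).

Definition subdiv e := [seq sub_fwd i | i <- enum 'I_(size (emap f e))].

Lemma sub_dir_invl a : sub_dir (invl a) = ~~ sub_dir a.
Proof. by rewrite /sub_dir /=; case: (a.2) (sub_letter _).2 => [] []. Qed.

Lemma sub_dir_fwd e i : sub_dir (sub_fwd (e := e) i).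
Proof. exact: eqxx. Qed.

Lemma sub_fwdE a : sub_dir a -> a = sub_fwd (tagged a.1).
Proof. by case: a => -[e i] b /eqP /= ->. Qed.

Lemma size_subdiv e : size (subdiv e) = size (emap f e).
Proof. by rewrite size_map size_enum_ord. Qed.

Lemma subdiv_lab e : map (relabel sub_lab) (subdiv e) = emap f e.
Proof.
rewrite -map_comp -[RHS](map_tnth_enum (in_tuple (emap f e))).
by apply: eq_map => i /=; rewrite [RHS]surjective_pairing.
Qed.

Lemma subst_subdiv_lab w : map (relabel sub_lab) (subst subdiv w) = wmap f w.
Proof.
have sE e : subst (fun x => [:: (sub_lab x, true)]) (subdiv e) = emap f e.
  by rewrite -map_relabel subdiv_lab.
rewrite map_relabel subst_comp; congr flatten; apply: eq_map => -[e b].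
by rewrite /slet /lmap sE.
Qed.

Lemma emap_gt0 e : (0 < size (emap f e))%N.
Proof. by rewrite lt0n size_eq0 emap_neq0. Qed.

Lemma sub_pt_size e : sub_pt e (size (emap f e)) = inl (tgt e).
Proof. by rewrite /sub_pt eqn0Ngt emap_gt0 eqxx. Qed.

Lemma take_subdiv e (i : 'I_(size (emap f e))) :
  take i.+1 (subdiv e) = rcons (take i (subdiv e)) (sub_fwd i).
Proof.
rewrite (take_nth (sub_fwd i)) ?size_subdiv ?ltn_ord // (nth_map i) ?size_enum_ord //.
by rewrite nth_ord_enum.
Qed.

Lemma walk_take_subdiv e i : (i <= size (emap f e))%N ->
  walk sub_org (sub_pt e 0) (take i (subdiv e)) (sub_pt e i).
Proof.
elim: i => [|i IHi] ie; first by rewrite take0 /=.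
rewrite (take_subdiv (Ordinal ie)) -cats1; apply: walk_cat (IHi (ltnW ie)) _.
by rewrite /= /sub_org sub_dir_fwd sub_dir_invl sub_dir_fwd !eqxx.
Qed.

Lemma walk_subdiv (a : edge G * bool) :
  walk sub_org (inl (origin a)) (slet subdiv a) (inl (terminus a)).
Proof.
have w e : walk sub_org (inl (src e)) (subdiv e) (inl (tgt e)).
  have := walk_take_subdiv (leqnn (size (emap f e))).
  by rewrite sub_pt_size -{1}(size_subdiv e) take_size.
by case: a => e []; [apply: w | apply/walk_invw/w].
Qed.

Lemma sorted_subdiv e : sorted (step sub_org) (subdiv e).
Proof.
have so : sorted (fun i j : 'I_(size (emap f e)) => i.+1 == j :> nat)
    (enum 'I_(size (emap f e))).
  have := @sorted_map _ _ (@nat_of_ord (size (emap f e))) (fun i j => i.+1 == j).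
  have pio k : forall m, path (fun i j => i.+1 == j) m (iota m.+1 k).
    by elim: k => //= k IHk m; rewrite eqxx IHk.
  move=> <-; rewrite val_enum_ord; case: (size _) => //= k; exact: pio.
rewrite /subdiv sorted_map; apply: sub_sorted so => i j /= /eqP ij.
apply/andP; split.
  by rewrite /sub_org sub_dir_invl !sub_dir_fwd /= ij.
apply/eqP=> /(congr1 fst) /= /eqP; rewrite eq_Tagged /= => /eqP /(congr1 val) /= ji.
by move: ij; rewrite ji => /eqP; rewrite eqn_leq ltnn.
Qed.

Lemma slet_subdiv_dir (a : edge G * bool) b :
  b \in slet subdiv a -> tag b.1 = a.1 /\ sub_dir b = a.2.
Proof.
case: a => e [] /=; rewrite /slet /=; first by case/mapP=> i _ ->; rewrite sub_dir_fwd.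
rewrite mem_invw => /mapP[i _ /(canRL (@invlK _)) ->].
by rewrite sub_dir_invl sub_dir_fwd.
Qed.

Lemma slet_subdiv_neq0 (a : edge G * bool) : slet subdiv a <> [::].
Proof.
move/(congr1 size); rewrite /slet; case: (a.2); rewrite ?size_invw size_subdiv;
  by move=> e0; have := emap_gt0 a.1; rewrite e0.
Qed.

(** A backtrack at a joint would be one inside a single subdivided edge, and
    come from a backtrack in the loop itself. *)
Lemma cycle_subdiv w :
  cycle (step (@origin G)) w -> cycle (step sub_org) (subst subdiv w).
Proof.
apply: cycle_flatten => [a|a|a b x y p q ab Ea Eb].
- exact: slet_subdiv_neq0.
- by case: a => e []; rewrite /slet /= ?sorted_invw // sorted_subdiv.
case/andP: ab => /eqP ab nab; apply/andP; split.
  have := walk_subdiv b; have := walk_subdiv a.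
  rewrite Ea Eb -cats1 => /walk_split[z _ /= /andP[/eqP _ /eqP->]] /andP[/eqP-> _].
  by rewrite ab.
apply: contraNneq nab => yx.
have [xa da] : tag x.1 = a.1 /\ sub_dir x = a.2.
  by apply: slet_subdiv_dir; rewrite Ea mem_rcons mem_head.
have [yb db] : tag y.1 = b.1 /\ sub_dir y = b.2.
  by apply: slet_subdiv_dir; rewrite Eb mem_head.
move: yb db; rewrite yx sub_dir_invl /= xa da.
by case: a b {ab Ea Eb xa da} => e s [e' s'] /= -> <-.
Qed.

(** A path between vertices of the subdivision is moved to a path of G by
    pulling its ends back to the sources of the edges that contain them, along
    the words [sub_prefix]. *)
Definition sub_base (z : sub_vertex) := match z with inl y => y | inr p => src p.1 end.

Definition sub_prefix (z : sub_vertex) : freegroup sub_edge :=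
  if z is inr p then redword (take p.2 (subdiv p.1)) else 1%g.

Lemma sub_base_pt e i : (i < size (emap f e))%N -> sub_base (sub_pt e i) = src e.
Proof.
by move=> ie; rewrite /sub_pt; case: eqP => // _; rewrite (ltn_eqF ie).
Qed.

Lemma sub_prefix_pt e i : (i < size (emap f e))%N ->
  sub_prefix (sub_pt e i) = redword (take i (subdiv e)).
Proof.
move=> ie; rewrite /sub_pt; case: eqP => [->|_]; first by rewrite take0.
by rewrite (ltn_eqF ie).
Qed.

Definition sub_homotopic y w u z := redword w =
  ((sub_prefix y)^-1 * redword (subst subdiv u) * sub_prefix z)%g.

Lemma sub_fwd_homotopic e (i : 'I_(size (emap f e))) :
  exists2 u, walk (@origin G) (sub_base (sub_pt e i)) u (sub_base (sub_pt e i.+1))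
    & sub_homotopic (sub_pt e i) [:: sub_fwd i] u (sub_pt e i.+1).
Proof.
have ie := ltn_ord i; rewrite /sub_homotopic sub_base_pt // sub_prefix_pt //.
have pre : redword [:: sub_fwd i] =
    ((redword (take i (subdiv e)))^-1 * redword (take i.+1 (subdiv e)))%g.
  by rewrite take_subdiv -cats1 redword_cat mulgA mulVg mul1g.
have [ie1|ie1] := ltnP i.+1 (size (emap f e)).
  exists [::]; rewrite ?sub_base_pt //= ?sub_prefix_pt // pre.
  by rewrite redword_nil mulg1.
have -> : i.+1 = size (emap f e) by apply/eqP; rewrite eqn_leq ie.
exists [:: (e, true)]; first by rewrite sub_pt_size /= /origin /= !eqxx.
rewrite sub_pt_size mulg1 /= pre; congr (_ * _)%g.
rewrite (_ : i.+1 = size (emap f e)); last by apply/eqP; rewrite eqn_leq ie.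
by rewrite -{1}size_subdiv take_size /subst /= cats0.
Qed.

Lemma sub_walk_homotopic z w t : walk sub_org z w t ->
  exists2 u, walk (@origin G) (sub_base z) u (sub_base t) & sub_homotopic z w u t.
Proof.
have letterP a : exists2 u,
    walk (@origin G) (sub_base (sub_org a)) u (sub_base (sub_org (invl a)))
    & sub_homotopic (sub_org a) [:: a] u (sub_org (invl a)).
  have fwdP c : sub_dir c -> exists2 u,
      walk (@origin G) (sub_base (sub_org c)) u (sub_base (sub_org (invl c)))
      & sub_homotopic (sub_org c) [:: c] u (sub_org (invl c)).
    move=> dc; rewrite /sub_org sub_dir_invl dc /=.
    by have := sub_fwd_homotopic (tagged c.1); rewrite -(sub_fwdE dc).
  have [/fwdP//|na] := boolP (sub_dir a).
  have [|u wu hu] := fwdP (invl a); first by rewrite sub_dir_invl.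
  rewrite invlK in wu hu; exists (invw u); first exact: walk_invw.
  rewrite /sub_homotopic -[[:: a]]invwK.
  have -> : invw [:: a] = [:: invl a] by [].
  rewrite redword_invw hu subst_invw redword_invw !invgM invgK.
  by rewrite mulgA.
elim: w z => [|a w IHw] z /=.
  move/eqP->; exists [::]; rewrite /= ?eqxx // /sub_homotopic redword_nil mulg1.
  by rewrite mulVg.
case/andP=> /eqP<- /IHw[u wu hu]; have [u' wu' hu'] := letterP a.
exists (u' ++ u); first exact: walk_cat wu' wu.
rewrite /sub_homotopic -cat1s redword_cat hu' hu subst_cat redword_cat.
by rewrite !mulgA mulgK.
Qed.

Lemma sub_closed_conj w : closed_walk sub_org w ->
  exists2 u, closed_walk (@origin G) u & conjw w (subst subdiv u).
Proof.
case: w => [|a w]; first by exists [::] => //; apply: conjw_refl.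
case/sub_walk_homotopic=> u /walk_closed cu hu; exists u => //.
by exists (sub_prefix (sub_org a))^-1%g; rewrite hu invgK.
Qed.

End Subdivision.

(** * Markings *)

Section FreeGens.
Variable n : nat.

Definition gen (i : 'I_n) : Fr n := redword [:: (i, true)].

Lemma morph1 (H : groupType) (h : Fr n -> H) :
  {morph h : x y / (x * y)%g} -> h 1%g = 1%g.
Proof. by move=> hM; apply: (mulIg (h 1%g)); rewrite -hM !mul1g. Qed.

Lemma morphVg (H : groupType) (h : Fr n -> H) x :
  {morph h : x y / (x * y)%g} -> h (x^-1)%g = ((h x)^-1)%g.
Proof. by move=> hM; apply: (mulIg (h x)); rewrite -hM !mulVg morph1. Qed.

Lemma redword_letter (w : seq ('I_n * bool)) i b :
  redword ((i, b) :: w) = ((if b then gen i else (gen i)^-1) * redword w)%g :> Fr n.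
Proof.
rewrite -cat1s redword_cat; congr (_ * _)%g; case: b => //.
by rewrite /gen -redword_invw.
Qed.

Lemma morph_gens (Y : choiceType) (h : Fr n -> freegroup Y) w :
  {morph h : x y / (x * y)%g} ->
  h (redword w) = redword (subst (fun i => word (h (gen i))) w).
Proof.
move=> hM; elim: w => [|[i b] w IHw]; first exact: morph1.
rewrite redword_letter hM IHw -[subst _ (_ :: w)]/(slet _ (i, b) ++ subst _ w).
rewrite redword_cat; congr (_ * _)%g; rewrite /slet /=.
by case: b; rewrite ?morphVg // ?redword_invw redwordK.
Qed.

Lemma hom_gens (h : Fr n -> bool) w :
  {morph h : x y / (x * y)%g >-> x (+) y} ->
  h (redword w) = hol (fun i => h (gen i)) w.
Proof.
move=> hM; have h1 : h 1%g = false.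
  by have := hM 1%g 1%g; rewrite mul1g addbb.
elim: w => [|[i b] w IHw] //; rewrite redword_letter hM IHw /=; congr (_ (+) _).
case: b => //; have := hM (gen i)^-1%g (gen i); rewrite mulVg h1.
by case: (h _) (h _) => [] [].
Qed.

End FreeGens.

Section Marking.
Variables (n : nat) (G : graph) (m : marking n G).
Hypothesis Gc : connected G.
Local Notation walkG := (walk (@origin G)).

Lemma edge_pathE x w y : edge_path x w y = walkG x w y.
Proof. by elim: w x => //= a w IHw x; rewrite IHw. Qed.

Lemma mark_pi1 w : walkG (basepoint m) w (basepoint m) -> exists g, m g = redword w.
Proof.
move=> ww; have : pi1 (basepoint m) (redword w).
  by apply: edge_path_tighten; rewrite edge_pathE.
by rewrite -mark_im => -[g _ gw]; exists g.
Qed.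

Lemma walk_mark g : walkG (basepoint m) (word (m g)) (basepoint m).
Proof.
have : range m (m g) by exists g.
by rewrite mark_im => gp; rewrite -edge_pathE.
Qed.

Definition qpath x := sval (cid (Gc (basepoint m) x)).

Lemma qpathP x : walkG (basepoint m) (qpath x) x.
Proof. by rewrite -edge_pathE; apply: (svalP (cid (Gc (basepoint m) x))). Qed.

Lemma edge_elt_ex e :
  exists g, m g = redword (qpath (src e) ++ [:: (e, true)] ++ invw (qpath (tgt e))).
Proof.
apply: mark_pi1; apply: walk_cat (qpathP _) _; apply: (walk_cat (y := tgt e)).
  by rewrite /= /origin /= !eqxx.
exact/walk_invw/qpathP.
Qed.

(** The generator of F_n that an edge gives when it is closed up by the
    chosen paths from the base point. *)
Definition edge_elt e := sval (cid (edge_elt_ex e)).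

Definition edge_word e := word (edge_elt e).

(** Replacing edges by their generators closes up a path by the chosen paths
    from the base point, as these cancel at the interior vertices. *)
Lemma edge_word_walk x u z : walkG x u z ->
  m (redword (subst edge_word u)) =
  (redword (qpath x) * redword u * (redword (qpath z))^-1)%g.
Proof.
have eltP e : m (edge_elt e) =
    (redword (qpath (src e)) * redword [:: (e, true)] * (redword (qpath (tgt e)))^-1)%g.
  by rewrite (svalP (cid (edge_elt_ex e))) !redword_cat redword_invw mulgA.
have letterP a : m (redword (slet edge_word a)) = (redword (qpath (origin a)) *
    redword [:: a] * (redword (qpath (origin (invl a))))^-1)%g.
  case: a => e []; rewrite /slet /= ?redword_invw redwordK; first exact: eltP.
  rewrite morphVg ?eltP; last exact: markM.
  by rewrite !invgM invgK -[((redword [:: _])^-1)%g]redword_invw mulgA.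
elim: u x => [|a u IHu] x /=.
  by move/eqP->; rewrite redword_nil mulg1 mulgV morph1 //; apply: markM.
case/andP=> /eqP<- /IHu e; rewrite -[subst _ _]/(slet edge_word a ++ subst edge_word u).
rewrite redword_cat markM letterP e -[a :: u]cat1s redword_cat.
by rewrite !mulgA mulgVK.
Qed.

Lemma mark_closed w : closed_walk (@origin G) w -> exists g, conjw w (word (m g)).
Proof.
case: w => [|a w] cw; first by exists 1%g; rewrite morph1; [apply: conjw_refl | apply: markM].
have wq := qpathP (origin a).
have [g gE] := mark_pi1 (walk_cat wq (walk_cat cw (walk_invw wq))).
exists g; apply: conjw_sym; apply: conjw_trans (conjw_conj (qpath (origin a)) _).
by apply: conjw_redword; rewrite redwordK gE.
Qed.

(** The conjugator is the chosen path from the base point to itself. *)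
Lemma edge_word_mark g : conjw (subst edge_word (word (m g))) (word g).
Proof.
have [h hE] := mark_pi1 (qpathP (basepoint m)).
exists h; apply: (mark_inj (m := m)); rewrite (edge_word_walk (walk_mark g)).
by rewrite !redwordK !markM morphVg ?hE //; apply: markM.
Qed.

(** The cochain on G that represents a homomorphism from F_n to Z/2. *)
Definition hom_cochain (chi : 'I_n -> bool) e := hol chi (edge_word e).

Lemma hol_mark chi g : hol (hom_cochain chi) (word (m g)) = hol chi (word g).
Proof. by rewrite -hol_subst (hol_conjw _ (edge_word_mark g)). Qed.

End Marking.

(** * Double covers of marked graphs *)

Section ChangeSheets.
Variables (G : graph) (k k' : edge G -> bool) (t : vertex G -> bool).
Hypothesis kt : forall e, k e = k' e (+) (t (src e) (+) t (tgt e)).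

(** Cohomologous cochains define the same double cover: t renames sheets. *)
Definition change_sheets (c : {ffun edge G * bool -> bool}) :
  {ffun edge G * bool -> bool} := [ffun x => c (x.1, x.2 (+) t (src x.1))].

Lemma change_sheetsD c d : change_sheets (c + d) = change_sheets c + change_sheets d.
Proof. by apply/ffunP=> x; rewrite !ffunE. Qed.

Lemma change_sheets0 : change_sheets 0 = 0.
Proof. by apply/ffunP=> x; rewrite !ffunE. Qed.

Lemma wt_change_sheets (R : realType) (v : edge G -> R) c :
  wt v (change_sheets c) = wt v c.
Proof.
pose h (x : edge G * bool) := (x.1, x.2 (+) t (src x.1)).
have hK : involutive h by case=> e s; rewrite /h /= addbK.
rewrite /wt (reindex_inj (inv_inj hK)) /=; apply: eq_big => x; rewrite ?ffunE //=.
by rewrite addbK; case: x.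
Qed.

Lemma ch_change_sheets x u z s : walk (@origin G) x u z ->
  ch k (s (+) t x) u = change_sheets (ch k' s u).
Proof.
elim: u x s => [|a u IHu] x s /=; first by rewrite !ch_nil change_sheets0.
case/andP=> /eqP<- /IHu wu; rewrite !ch_cons change_sheetsD; congr (_ + _).
  apply/ffunP=> -[e s']; rewrite !ffunE /lift1 /= !xpair_eqE; case: eqVneq => //= ->.
  case: a {wu} => e' b; rewrite /origin /= kt; case: b => /=.
    by case: s s' (t _) => [] [] [].
  by case: s s' (t _) (t _) (k' _) => [] [] [] [] [].
rewrite -wu; congr ch; case: a {wu} => e b; rewrite /origin /= kt.
by case: b; case: s (t _) (t _) (k' _) => [] [] [] [].
Qed.

End ChangeSheets.

Section CycleCount.
Variables (n : nat) (G : graph) (m : marking n G).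
Hypothesis Gc : connected G.
Local Notation xi := (hom_cochain m Gc).
Local Notation index := ({ffun 'I_n -> bool} * {ffun edge G * bool -> bool})%type.

(** The index set of the potential: the nonzero cycles that closed paths trace
    in the double covers of G, where each double cover is named by a
    homomorphism from F_n to Z/2. *)
Definition lifted_cycle (j : index) := exists s g,
  hol j.1 (word g) = false /\ j.2 = ch (xi j.1) s (word (m g)).

Definition cycles : {set index} := [set j : index | (j.2 != 0) && `[< lifted_cycle j >]].

(** The lifts of the generators of F_n span the cycles of a double cover. *)
Lemma card_cycles : (#|cycles| <= 2 ^ n * (2 ^ (2 * n) - 1))%N.
Proof.
pose T : finType := ({ffun 'I_n -> bool} * {ffun 'I_n * bool -> bool})%type.
pose F (p : T) : index :=
  (p.1, subst_chain (xi p.1) (fun i => word (m (gen i))) p.2).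
pose A := finset.setX [set: {ffun 'I_n -> bool}] [set~ (0 : {ffun 'I_n * bool -> bool})].
have AF : cycles \subset F @: A.
  apply/fintype.subsetP=> -[chi c]; rewrite inE /= => /andP[c0 /asboolP[s [g [/= hg cE]]]].
  pose d := ch (fun i => hol (xi chi) (word (m (gen i)))) s (word g).
  have cd : c = subst_chain (xi chi) (fun i => word (m (gen i))) d.
    rewrite cE -ch_subst; apply: ch_redword.
    by rewrite -morph_gens ?redwordK //; apply: markM.
  apply/imsetP; exists (chi, d); last by rewrite /F /= -cd.
  by rewrite !inE /=; apply: contraNneq c0 => d0; rewrite cd d0 subst_chain0.
apply: leq_trans (subset_leq_card AF) _; apply: leq_trans (leq_imset_card _ _) _.
rewrite cardsX cardsT cardsC1 !card_ffun card_bool card_ord card_prod card_ord card_bool.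
by rewrite [(n * 2)%N]mulnC subn1.
Qed.

End CycleCount.

(** * A homotopy equivalence does not shrink loops too much *)

Section Pullback.
Variable n : nat.
Implicit Types (chi : 'I_n -> bool) (g : Fr n).

Definition pull (h : Fr n -> Fr n) chi : {ffun 'I_n -> bool} :=
  [ffun i => hol chi (word (h (gen i)))].

Lemma hol_pull h chi g : {morph h : x y / (x * y)%g} ->
  hol (pull h chi) (word g) = hol chi (word (h g)).
Proof.
move=> hM; pose F x := hol chi (word (h x)).
have FM : {morph F : x y / (x * y)%g >-> x (+) y}.
  move=> x y; rewrite /F hM -hol_cat; apply: hol_redword.
  by rewrite redwordK redword_cat !redwordK.
rewrite -/(F g) -{2}(redwordK g) (hom_gens _ FM).
by apply: eq_hol => i; rewrite ffunE.
Qed.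

Lemma pullK (h h' : Fr n -> Fr n) (chi : {ffun 'I_n -> bool}) :
  {morph h' : x y / (x * y)%g} -> cancel h h' -> pull h (pull h' chi) = chi.
Proof.
by move=> h'M hK; apply/ffunP=> i; rewrite ffunE hol_pull // hK /= addbF.
Qed.

End Pullback.

Section BackwardBound.
Variables (n : nat) (G : graph) (m : marking n G) (f : graph_map G).
Variable phi : aut (Fr n).
Hypothesis Gc : connected G.
Hypothesis f_phi : induces f m phi.

Local Notation xi := (hom_cochain m Gc).
Local Notation bp := (basepoint m).
Local Notation lab := (@sub_lab G f).
Local Notation chain := {ffun edge G * bool -> bool}.
Local Notation index := ({ffun 'I_n -> bool} * chain)%type.
Implicit Types (psi chi : {ffun 'I_n -> bool}) (g : Fr n) (j : index).

Lemma induces_conj g : conjw (word (m (phi g))) (wmap f (word (m g))).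
Proof.
have [sigma [_ sE]] := f_phi; exists sigma.
by rewrite redwordK sE.
Qed.

(** Double covers of G correspond under f by precomposition with phi; [image_hom]
    goes in the direction of f. *)
Definition image_hom psi := pull (aut_finv phi) psi.

(** The cover of G that f pulls back from the cover [image_hom psi] is the cover
    of psi, but with other names for the sheets, related by [sheet_change]. *)
Definition pulled_cochain psi e := hol (xi (image_hom psi)) (emap f e).

Lemma hol_wmap chi g :
  hol (xi chi) (wmap f (word (m g))) = hol chi (word (phi g)).
Proof. by rewrite -(hol_mark m Gc) (hol_conjw _ (induces_conj g)). Qed.

Lemma hol_image_hom psi g : hol (image_hom psi) (word (phi g)) = hol psi (word g).
Proof. by rewrite hol_pull ?autK //; apply: aut_finvM. Qed.

Lemma hol_pulled_cochain psi g :
  hol (pulled_cochain psi) (word (m g)) = hol (xi psi) (word (m g)).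
Proof. by rewrite -hol_subst [LHS]hol_wmap hol_image_hom hol_mark. Qed.

Definition sheet_change psi x :=
  hol (pulled_cochain psi) (qpath m Gc x) (+) hol (xi psi) (qpath m Gc x).

Lemma pulled_cochainE psi e : pulled_cochain psi e =
  xi psi e (+) (sheet_change psi (src e) (+) sheet_change psi (tgt e)).
Proof.
have ge := svalP (cid (edge_elt_ex m Gc e)).
have := hol_pulled_cochain psi (edge_elt m Gc e).
rewrite -/(edge_elt m Gc e) -(redwordK (m _)) in ge; rewrite !(hol_redword _ ge).
rewrite !hol_cat !hol_invw /= !addbF /sheet_change.
by case: (pulled_cochain _ e) (hol (pulled_cochain psi) _)
  (hol (pulled_cochain psi) _) (xi psi e) (hol (xi psi) _) (hol (xi psi) _) =>
  [] [] [] [] [] [].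
Qed.

(** The subdivision of the cycle j, in the double cover of the subdivided graph
    that f pulls back. *)
Definition sub_cycle j := subst_chain (xi (image_hom j.1) \o lab) (subdiv f)
  (change_sheets (sheet_change j.1) j.2).

Lemma sub_cycle_ch psi s g :
  sub_cycle (psi, ch (xi psi) s (word (m g))) =
  ch (xi (image_hom psi) \o lab) (s (+) sheet_change psi bp)
    (subst (subdiv f) (word (m g))).
Proof.
rewrite ch_subst /sub_cycle /=; congr subst_chain.
rewrite -(ch_change_sheets (pulled_cochainE psi) _ (walk_mark m g)).
by apply: eq_ch => e; rewrite -hol_relabel subdiv_lab.
Qed.

Definition image_cycle j : index := (image_hom j.1, push_chain lab (sub_cycle j)).

Lemma image_cycle_ch psi s g :
  image_cycle (psi, ch (xi psi) s (word (m g))) =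
  (image_hom psi, ch (xi (image_hom psi)) (s (+) sheet_change psi bp)
     (wmap f (word (m g)))).
Proof.
by rewrite /image_cycle sub_cycle_ch push_ch subst_subdiv_lab.
Qed.

Let Z : {set index} := [set j : index | `[< lifted_cycle m Gc j >]].

Lemma lifted_cycle0 psi : lifted_cycle m Gc ((psi, 0) : index).
Proof.
exists false, 1%g; split=> //=.
by rewrite morph1 ?ch_nil //; apply: markM.
Qed.

(** Each cycle in a double cover is the image of one: lift it to F_n and
    apply the inverse of phi. *)
Lemma image_cycle_surj : Z \subset image_cycle @: Z.
Proof.
apply/fintype.subsetP=> -[chi c]; rewrite inE => /asboolP[s [g [/= hg cE]]].
pose psi := pull phi chi; pose g' := aut_finv phi g.
have imE : image_hom psi = chi by apply: pullK (@autM _ phi) (@autVK _ phi).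
have phig : phi g' = g by apply: autVK.
have hg' : hol psi (word g') = false by rewrite -hol_image_hom imE phig.
have hw : hol (xi chi) (wmap f (word (m g'))) = false by rewrite hol_wmap phig.
have cg := induces_conj g'; rewrite phig in cg; have [s' es] := ch_conjw s cg hw.
apply/imsetP; exists (psi, ch (xi psi) (s' (+) sheet_change psi bp) (word (m g'))).
  by rewrite inE; apply/asboolP; exists (s' (+) sheet_change psi bp), g'.
by rewrite image_cycle_ch addbK imE cE es.
Qed.

(** Being onto a finite set of the same size, it is injective; in particular,
    f kills no nonzero cycle. *)
Lemma image_cycle_inj : {in Z &, injective image_cycle}.
Proof.
apply/imset_injP; rewrite eqn_leq leq_imset_card.
exact: subset_leq_card image_cycle_surj.
Qed.

Lemma image_cycle_Z : image_cycle @: Z = Z.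
Proof.
apply/esym/eqP; rewrite eqEcard image_cycle_surj.
by rewrite leq_imset_card.
Qed.

Lemma sub_cycle0 psi : sub_cycle (psi, 0) = 0.
Proof. by rewrite /sub_cycle /= change_sheets0 subst_chain0. Qed.

Lemma image_cycle_neq0 j : j \in cycles m Gc -> push_chain lab (sub_cycle j) != 0.
Proof.
case: j => psi c; rewrite inE /= => /andP[c0 lc]; apply: contraNneq c0 => p0.
have e : image_cycle (psi, c) = image_cycle (psi, 0).
  by rewrite /image_cycle p0 sub_cycle0 push_chain0.
have Zc : (psi, c) \in Z by rewrite inE.
have Z0 : (psi, 0) \in Z by rewrite inE; apply/asboolP/lifted_cycle0.
by have [->] := image_cycle_inj Zc Z0 e.
Qed.

Lemma image_cycle_cycles : image_cycle @: cycles m Gc = cycles m Gc.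
Proof.
have injC : {in cycles m Gc &, injective image_cycle}.
  by move=> i j; rewrite !inE => /andP[_ Zi] /andP[_ Zj]; apply: image_cycle_inj; rewrite inE.
apply/eqP; rewrite eqEcard (card_in_imset injC) leqnn andbT.
apply/fintype.subsetP=> _ /imsetP[j Cj ->]; rewrite inE image_cycle_neq0 //=.
have : image_cycle j \in image_cycle @: Z.
  by apply: imset_f; move: Cj; rewrite !inE => /andP[_ /asboolP].
by rewrite image_cycle_Z inE.
Qed.

Variable R : realType.
Variables (v : edge G -> R) (lam : R).
Hypothesis v0 : forall e, 0 < v e.
Hypothesis v_lam : forall e, len v (emap f e) = lam * v e.

(** Closed paths of the subdivision are homotopic to subdivided closed paths of
    G, so its cycles are the subdivided ones, and since f is a homotopy
    equivalence, every cochain is cohomologous to one that is pulled back from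
    G. *)
Lemma sub_cover_family : cover_family (fun chi : {ffun 'I_n -> bool} => xi chi)
  (mem (cycles m Gc)) (@sub_org G f) lab sub_cycle.
Proof.
split=> [chi s w cw hw cn | j Cj | k].
- have [u cu wu] := sub_closed_conj cw; have [g ug] := mark_closed m Gc cu.
  have {wu ug}wg : conjw w (subst (subdiv f) (word (m g))).
    exact: conjw_trans wu (conjw_subst _ ug).
  pose psi := pull phi chi.
  have imE : image_hom psi = chi by apply: pullK (@autM _ phi) (@autVK _ phi).
  have hw' : hol (xi chi \o lab) (subst (subdiv f) (word (m g))) = false.
    by rewrite -(hol_conjw _ wg).
  have [s' es] := ch_conjw s wg hw'; move: cn; rewrite {}es => cn.
  have hg : hol psi (word g) = false.
    by rewrite hol_pull -?hol_wmap -?subst_subdiv_lab ?hol_relabel //; apply: autM.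
  pose c := ch (xi psi) (s' (+) sheet_change psi bp) (word (m g)).
  have cE : sub_cycle (psi, c) = ch (xi chi \o lab) s' (subst (subdiv f) (word (m g))).
    by rewrite sub_cycle_ch addbK imE.
  have Dj : (psi, c) \in cycles m Gc.
    rewrite inE /= (_ : c != 0) //=; last first.
      by apply: contraNneq cn => c0; rewrite -cE c0 sub_cycle0.
    by apply/asboolP; exists (s' (+) sheet_change psi bp), g.
  by exists (psi, c).
- exact: image_cycle_neq0.
pose kG e := hol k (subdiv f e).
pose h g := hol kG (word (m (aut_finv phi g))).
have hM : {morph h : x y / (x * y)%g >-> x (+) y}.
  move=> x y; rewrite /h aut_finvM markM -hol_cat; apply: hol_redword.
  by rewrite redwordK redword_cat !redwordK.
exists [ffun i => h (gen i)] => w cw.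
have [u cu wu] := sub_closed_conj cw; have [g ug] := mark_closed m Gc cu.
have {wu ug}wg : conjw w (subst (subdiv f) (word (m g))).
  exact: conjw_trans wu (conjw_subst _ ug).
rewrite !(hol_conjw _ wg) [LHS]hol_subst -/kG -[RHS]hol_relabel.
rewrite subst_subdiv_lab hol_wmap.
rewrite (@eq_hol _ _ (fun i => h (gen i))) => [|i]; last by rewrite ffunE.
by rewrite -(hom_gens _ hM) redwordK /h autK.
Qed.

(** Pull the lengths of G back to its subdivision. The potential of the
    subdivision is at most lam to the number of cycles times that of G, and
    folding the subdivision to G turns the one into the other. *)
Theorem backward_length_bound (a : seq (edge G * bool)) :
  0 <= lam -> cycle (step (@origin G)) a ->
  exists b, [/\ cycle (@reduced_step _) b, conjw b (wmap f a)
    & lam * len v a <= lam ^+ #|cycles m Gc| * len v b].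
Proof.
move=> lam0 ca.
have [b [cb ab lb]] := folding_inequality v0 sub_cover_family (cycle_subdiv f ca).
rewrite subst_subdiv_lab in ab; exists b; split=> //.
have lE e : len (v \o lab) (subdiv f e) = lam * v e.
  by rewrite -len_relabel subdiv_lab.
have la : len (v \o lab) (subst (subdiv f) a) = lam * len v a.
  rewrite len_subst /len mulr_sumr; apply: eq_bigr => x _; exact: lE.
rewrite {}la in lb.
set Q := \prod_(j in cycles m Gc) wt v j.2.
have QE : \prod_(j in cycles m Gc) wt v (push_chain lab (sub_cycle j)) = Q.
  rewrite /Q -[in RHS]image_cycle_cycles big_imset //= => i j.
  by rewrite !inE => /andP[_ Zi] /andP[_ Zj]; apply: image_cycle_inj; rewrite inE.
have PE : \prod_(j in cycles m Gc) wt (v \o lab) (sub_cycle j) <=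
    lam ^+ #|cycles m Gc| * Q.
  rewrite -prodr_const -big_split /=; apply: ler_prod => j _.
  have vl0 e : 0 < (v \o lab) e by apply: v0.
  rewrite wt_ge0 //=; apply: le_trans (wt_subst_chain _ _ _ vl0) _.
  rewrite -(wt_change_sheets (sheet_change j.1) v) /wt mulr_sumr.
  by rewrite le_eqVlt; apply/orP; left; apply/eqP/eq_bigr => x _; apply: lE.
have Q0 : 0 < Q.
  by apply: prodr_gt0 => j; rewrite inE => /andP[j0 _]; apply: wt_gt0.
rewrite -(ler_pM2r Q0) -{1}QE; apply: le_trans lb _.
rewrite [leRHS]mulrAC [leRHS]mulrC ler_wpM2l ?len_ge0 // => e; exact: ltW.
Qed.

End BackwardBound.

(** * Loops that represent conjugacy classes *)

Section CyclicReduction.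
Variables (X : choiceType) (V : eqType) (org : X * bool -> V).
Implicit Types (x y z : V) (w : seq (X * bool)).

Lemma walk_last x a w y : walk org x (a :: w) y -> org (invl (last a w)) = y.
Proof.
by elim: w x a => [|b w IHw] x a /= /andP[_]; [move/eqP | apply: IHw].
Qed.

Lemma walk_path x a w y : walk org x (a :: w) y ->
  path (@reduced_step X) a w -> path (step org) a w.
Proof.
elim: w x a => [|b w IHw] x a //= /and3P[_ ba wb] /andP[rab pw].
by apply/andP; split; [apply/andP | apply: (IHw (org b)); rewrite //= eqxx].
Qed.

Lemma cyclic_reduction x w : walk org x w x -> tight w -> exists p y a,
  [/\ walk org x p y, walk org y a y, cycle (step org) a
    & redword w = (redword p * redword a * (redword p)^-1)%g].
Proof.
have [k] := ubnP (size w); elim: k x w => // k IHk x [|a w] /ltnSE wk ww tw.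
  by exists [::], x, [::]; rewrite /= eqxx; split; rewrite // redword_nil mul1g invg1 mulg1.
have [al|na] := eqVneq a (invl (last a w)); last first.
  exists [::], x, (a :: w); split=> //.
  - by rewrite /= eqxx.
  - rewrite /= rcons_path (walk_path ww tw) /= /step na (walk_last ww) andbT.
    by case/andP: ww.
  - by rewrite redword_nil mul1g invg1 mulg1.
case/lastP: w => [|w b] in wk ww tw al *.
  by have := invl_neq a; rewrite -al eqxx.
rewrite last_rcons in al; have {al}bE : b = invl a by rewrite al invlK.
subst b; case/andP: ww => /eqP ax; rewrite -cats1 => /walk_split[y ww /= /andP[/eqP ay _]].
subst y; rewrite -cats1 -cat_cons in tw.
have {}tw : tight w.
  by move: tw; rewrite /tight /= cat_path => /andP[/path_sorted].
have [|p [y [c [wp wc cc ec]]]] := IHk _ w _ ww tw.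
  by move: wk; rewrite /= size_rcons; apply: ltnW.
exists (a :: p), y, c; split=> //; first by rewrite /= ax eqxx.
rewrite -(cat1s a) -(cat1s a p) !redword_cat ec -[[:: invl a]]/(invw [:: a]) redword_invw.
by rewrite invgM !mulgA.
Qed.

End CyclicReduction.

Section Representatives.
Variables (n : nat) (G : graph) (m : marking n G).
Hypothesis Gc : connected G.

(** A loop of G together with a path from the base point that makes it a
    representative of g. Unlike conjugacy in the free group on the edges, this
    is conjugacy in the fundamental group of G. *)
Definition represented (g : Fr n) (a : seq (edge G * bool)) := exists p y,
  [/\ walk (@origin G) (basepoint m) p y, walk (@origin G) y a y
    & m g = (redword p * redword a * (redword p)^-1)%g].

Lemma represented_conj g a : represented g a -> conjw (word (m g)) a.
Proof. by case=> p [y [_ _ e]]; exists (redword p); rewrite redwordK. Qed.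

Lemma represented_ex g : exists2 a, cycle (step (@origin G)) a & represented g a.
Proof.
have [p [y [a [wp wa ca e]]]] := cyclic_reduction (walk_mark m g) (word_tight _).
by exists a => //; exists p, y; rewrite -e redwordK.
Qed.

Lemma represented_edge_word g a : represented g a ->
  conjw (subst (edge_word m Gc) a) (word g).
Proof.
case=> p [y [wp wa e]].
have [h hE] := mark_pi1 (walk_cat (qpathP m Gc y) (walk_invw wp)).
exists h; apply: (mark_inj (m := m)); rewrite (edge_word_walk m Gc wa).
rewrite !redwordK !markM morphVg; last exact: markM.
rewrite hE e redword_cat redword_invw !invgM invgK !mulgA.
by rewrite mulgVK mulgVK.
Qed.

(** Each edge of G stands for an element of F_n, which a fixed word in the edges
    of H represents; substituting these words turns a loop of G into one of H
    with the same conjugacy class. *)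
Lemma marking_change (R : realType) (H : graph) (m' : marking n H)
    (v : edge G -> R) (v' : edge H -> R) :
  (forall e, 0 < v e) -> (forall e, 0 < v' e) ->
  exists2 C, 0 <= C & forall g a, represented g a ->
    exists2 c, conjw c (word (m' g)) & len v' c <= C * len v a.
Proof.
move=> v0 v'0; pose s e := subst (fun i => word (m' (gen i))) (edge_word m Gc e).
pose r e := len v' (s e) / v e.
have v'0' e : 0 <= v' e by apply: ltW.
have r0 e : 0 <= r e by rewrite divr_ge0 ?len_ge0 // ltW.
exists (\sum_e r e); first by rewrite sumr_ge0.
move=> g a ga; exists (subst s a).
  rewrite -subst_comp; apply: conjw_trans (conjw_subst _ (represented_edge_word ga)) _.
  apply: conjw_redword; rewrite -morph_gens ?redwordK //; exact: markM.
rewrite len_subst /len mulr_sumr; apply: ler_sum => x _.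
by rewrite -ler_pdivrMr // (bigD1 x.1) //= lerDl sumr_ge0.
Qed.

Lemma mark_conj g h : conjw (word (m (g ^ h)%g)) (word (m g)).
Proof.
exists (m h)^-1%g; rewrite !redwordK conjgE !markM morphVg ?invgK ?mulgA //.
exact: markM.
Qed.

End Representatives.

(** * Growth *)

Section PerronVector.
Variables (R : realType) (G : graph) (f : graph_map G) (lam : R).
Hypothesis PF : PF_eigenvalue (transition_mx f R) lam.

Lemma len_count (v : edge G -> R) w :
  len v w = \sum_e v e * (count (fun a => a.1 == e) w)%:R.
Proof.
elim: w => [|a w IHw].
  by rewrite len_nil big1 // => e _; rewrite mulr0.
rewrite len_cons IHw (bigD1 a.1) //= [RHS](bigD1 a.1) //= eqxx natrD mulrDr mulr1 addrA.
congr (_ + _); apply: eq_bigr => e /negPf ne.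
by rewrite eq_sym ne.
Qed.

(** The left eigenvector gives edge lengths for which f stretches every edge by
    the same factor. *)
Lemma perron_lengths : exists2 v : edge G -> R, forall e, 0 < v e
  & forall e, len v (emap f e) = lam * v e.
Proof.
case: PF => _ _ [v [v0 vM]]; exists (fun e => v 0 (enum_rank e)) => // e.
move/matrixP/(_ 0 (enum_rank e)): vM; rewrite !mxE => <-.
rewrite len_count (reindex (fun i : 'I_#|edge G| => enum_val i)) /=;
  last exact/onW_bij/enum_val_bij.
by apply: eq_bigr => i _; rewrite !mxE enum_valK enum_rankK.
Qed.

(** The image of a shortest edge is at least as long as this edge. *)
Lemma perron_ge1 (e0 : edge G) : 1 <= lam.
Proof.
have [v v0 vlam] := perron_lengths.
have [|e _ emin] := seq_argmax (fun e => - v e) (s := enum (edge G)).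
  by have := mem_enum (edge G) e0; case: (enum _).
have := vlam e; have := @emap_neq0 _ f e.
case: (emap f e) => // a w _ eE.
rewrite -(ler_pM2r (v0 e)) mul1r -eE len_cons.
have := emin a.1; rewrite mem_enum lerN2 => /(_ isT) H.
by apply: le_trans H _; rewrite lerDl len_ge0 // => e'; apply: ltW.
Qed.

End PerronVector.

Lemma bernoulli (R : realType) (d : R) k : 0 <= d -> 1 + k%:R * d <= (1 + d) ^+ k.
Proof.
move=> d0; elim: k => [|k IHk]; first by rewrite mul0r addr0 expr0.
rewrite exprS -natr1; apply: (@le_trans _ _ ((1 + d) * (1 + k%:R * d))).
  by have := mulr_ge0 (mulr_ge0 (ler0n R k) d0) d0; lra.
by rewrite ler_wpM2l // addr_ge0.
Qed.

Lemma power_unbounded (R : realType) (x C : R) : 1 < x -> exists k, C < x ^+ k.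
Proof.
move=> x1; have d0 : 0 < x - 1 by rewrite subr_gt0.
have [C0|C0] := ltP C 0; first by exists 0%N; rewrite expr0; lra.
exists (Num.bound (C / (x - 1))); set k := Num.bound _.
have := archi_boundP (divr_ge0 C0 (ltW d0)); rewrite -/k ltr_pdivrMr // => Ck.
apply: lt_le_trans Ck _; have := bernoulli k (ltW d0).
by rewrite (_ : 1 + (x - 1) = x); [lra | ring].
Qed.

Section LegalLoop.
Variables (R : realType) (G : graph) (f : graph_map G).
Variables (v : edge G -> R) (mu : R).
Hypothesis v0 : forall e, 0 < v e.
Hypothesis v_mu : forall e, len v (emap f e) = mu * v e.
Implicit Types w : seq (edge G * bool).

Local Notation W k := (iter k (wmap f)).

Lemma iter_wmap_cat k u w : W k (u ++ w) = W k u ++ W k w.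
Proof. by elim: k => //= k ->; apply: subst_cat. Qed.

Lemma iter_wmap_neq0 k a w : W k (a :: w) != [::].
Proof.
elim: k => //= k; case: (W k _) => // b u _.
rewrite -size_eq0 -[wmap f _]/(lmap f b ++ wmap f u) size_cat addn_eq0 negb_and.
by apply/orP; left; case: b => e []; rewrite /lmap /= ?size_invw size_eq0 emap_neq0.
Qed.

Lemma len_iter_wmap k w : len v (W k w) = mu ^+ k * len v w.
Proof.
elim: k => [|k IHk]; first by rewrite mul1r.
rewrite iterS [LHS](len_subst v (emap f)) exprS -mulrA -IHk.
by rewrite /len mulr_sumr; apply: eq_bigr => a _; apply: v_mu.
Qed.

Lemma walk_wmap x w y : walk (@origin G) x w y ->
  walk (@origin G) (vmap f x) (wmap f w) (vmap f y).
Proof.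
elim: w x => [|a w IHw] x /=; first by move/eqP->.
case/andP=> /eqP<- /IHw ww.
rewrite -[wmap f _]/(lmap f a ++ wmap f w); apply: walk_cat ww.
case: a => e []; rewrite /lmap /origin /= -edge_pathE; first exact: emap_path.
exact/edge_path_invw/emap_path.
Qed.

Lemma walk_iter_wmap k x w y : walk (@origin G) x w y ->
  walk (@origin G) (iter k (vmap f) x) (W k w) (iter k (vmap f) y).
Proof. by move=> ww; elim: k => //= k; apply: walk_wmap. Qed.

(** In a long iterate of an edge some letter repeats. The segment between two
    occurrences is a loop, and since iterates of edges stay tight, so do, even
    cyclically, the iterates of this loop. *)
Lemma legal_loop (e0 : edge G) : train_track f -> 1 < mu ->
  exists w, [/\ w != [::], closed_walk (@origin G) w
    & forall k, cycle (@reduced_step _) (W k w)].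
Proof.
move=> tt mu1; pose M := \sum_e v e.
have vM e : v e <= M by rewrite /M (bigD1 e) //= lerDl sumr_ge0 // => *; apply: ltW.
have lenM w : len v w <= (size w)%:R * M.
  elim: w => [|a w IHw]; first by rewrite len_nil mul0r.
  by rewrite len_cons /= -natr1 mulrDl mul1r addrC lerD.
have M0 : 0 < M by apply: lt_le_trans (vM e0).
have [k hk] := power_unbounded (#|{: edge G * bool}|%:R * M / v e0) mu1.
have : ~~ uniq (W k [:: (e0, true)]).
  apply/negP=> /card_uniqP cu; move: hk; rewrite ltr_pdivrMr //.
  have -> : mu ^+ k * v e0 = len v (W k [:: (e0, true)]).
    by rewrite len_iter_wmap len_cons len_nil addr0.
  apply/negP; rewrite -leNgt; apply: le_trans (lenM _) _.
  by rewrite ler_wpM2r ?ler_nat ?(ltW M0) // -cu max_card.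
case/not_uniq_split=> x [p [q [r e]]]; exists (x :: q); split=> //.
  have : walk (@origin G) (src e0) [:: (e0, true)] (tgt e0).
    by rewrite /= /origin /= !eqxx.
  move/(walk_iter_wmap k); rewrite e => /walk_split[y _].
  rewrite -cat_cons => /walk_split[z wq /= /andP[/eqP xz _]].
  case/andP: (wq) => /eqP yx _.
  by rewrite -xz yx in wq; apply: walk_closed wq.
move=> j; have := tt (j + k)%N e0; rewrite iterD e -!cat_cons 2!iter_wmap_cat.
rewrite -[x :: r]cat1s iter_wmap_cat -[x :: q]cat1s.
rewrite iter_wmap_cat; have := iter_wmap_neq0 j x [::].
case: (W j [:: x]) => // y s _ t.
have {t} : tight (((y :: s) ++ W j q) ++ (y :: s)).
  move: t; rewrite /tight => /cat_sorted2[_]; rewrite [X in sorted _ X]catA.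
  by case/cat_sorted2.
by rewrite /tight /= -cat_rcons cat_path => /andP[].
Qed.

End LegalLoop.

Section Growth.
Variables (R : realType) (n : nat) (G : graph) (m : marking n G) (f : graph_map G).
Variables (phi psi : aut (Fr n)) (v : edge G -> R) (lam : R).
Hypothesis Gc : connected G.
Hypothesis f_phi : induces f m phi.
Hypothesis v0 : forall e, 0 < v e.
Hypothesis v_lam : forall e, len v (emap f e) = lam * v e.
Hypothesis lam1 : 1 <= lam.
Hypothesis phi_psi : forall g, exists h, phi (psi g) = (g ^ h)%g.

Local Notation N := #|cycles m Gc|.

(** The bound is applied to a, whose image under f represents the previous
    conjugacy class; any two cyclically tight representatives of that class
    have the same length. *)
Lemma inverse_growth k g a0 a :
  cycle (step (@origin G)) a0 -> conjw a0 (word (m g)) ->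
  cycle (step (@origin G)) a -> conjw a (word (m (iter k psi g))) ->
  len v a <= (lam ^+ N) ^+ k * len v a0.
Proof.
have v0' e : 0 <= v e by apply: ltW.
have lam0 : 0 <= lam by apply: le_trans lam1.
move=> ca0 g0; elim: k a => [|k IHk] a ca ga.
  rewrite mul1r; apply: cyclic_len_min => //; first exact: cycle_reduced ca.
  exact: conjw_trans g0 (conjw_sym ga).
have [b [cb ab lb]] := backward_length_bound Gc f_phi v0 v_lam lam0 ca.
have [a1 ca1 /represented_conj ga1] := represented_ex m (iter k psi g).
have ba1 : conjw a1 b.
  have [h hE] := phi_psi (iter k psi g).
  apply: conjw_trans (conjw_sym ga1) _; apply: conjw_trans _ (conjw_sym ab).
  apply: conjw_trans _ (conjw_sym (conjw_subst _ ga)).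
  apply: conjw_trans _ (induces_conj f_phi (psi (iter k psi g))).
  by rewrite hE; apply/conjw_sym/mark_conj.
apply: (@le_trans _ _ (lam * len v a)); first by rewrite ler_peMl // len_ge0.
apply: le_trans lb _; rewrite exprS -mulrA; apply: ler_wpM2l; first exact: exprn_ge0.
apply: le_trans (cyclic_len_min v0' cb ba1) _; apply: IHk ca1 _.
exact: conjw_sym.
Qed.

(** Iterate a legal loop of a train track for psi: its length grows exactly
    like the powers of mu, while the corresponding loops in G grow at most like
    the powers of lam to the number of cycles. *)
Theorem train_track_growth_le (H : graph) (m' : marking n H) (h : graph_map H)
    (v' : edge H -> R) (mu : R) (e0 : edge H) :
  connected H -> induces h m' psi -> train_track h ->
  (forall e, 0 < v' e) -> (forall e, len v' (emap h e) = mu * v' e) ->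
  mu <= lam ^+ N.
Proof.
move=> Hc h_psi tt v'0 v_mu; rewrite leNgt; apply/negP=> lt.
have v'0' e : 0 <= v' e by apply: ltW.
have v0' e : 0 <= v e by apply: ltW.
pose nu := lam ^+ N; have nu1 : 1 <= nu by apply: exprn_ege1.
have nu0 : 0 < nu by apply: lt_le_trans nu1.
have [w [wn cw wk]] := legal_loop v'0 v_mu e0 tt (le_lt_trans nu1 lt).
have [g wg] := mark_closed m' Hc cw.
have [C C0 hC] := marking_change m Gc m' v0 v'0.
have [a0 ca0 ga0] := represented_ex m g.
have w0 : 0 < len v' w.
  by case: (w) wn => // a u _; rewrite len_cons ltr_pwDl // len_ge0.
have wgk k : conjw (iter k (wmap h) w) (word (m' (iter k psi g))).
  elim: k => [|k IHk] //; rewrite !iterS.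
  exact: conjw_trans (conjw_subst _ IHk) (conjw_sym (induces_conj h_psi _)).
(* a large power of mu / nu exceeds the constant of the comparison *)
have [k hk] : exists k, C * len v a0 / len v' w < (mu / nu) ^+ k.
  by apply: power_unbounded; rewrite ltr_pdivlMr // mul1r.
have [a ca ga] := represented_ex m (iter k psi g).
have [c cg lc] := hC _ _ ga.
have := cyclic_len_min v'0' (wk k) (conjw_trans cg (conjw_sym (wgk k))).
rewrite (len_iter_wmap v_mu) => l1.
have l2 := inverse_growth ca0 (conjw_sym (represented_conj ga0)) ca
  (conjw_sym (represented_conj ga)).
move: hk; rewrite ltr_pdivrMr // expr_div_n mulrAC ltr_pdivlMr; last exact: exprn_gt0.
apply/negP; rewrite -leNgt; apply: le_trans l1 _; apply: le_trans lc _.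
by rewrite -mulrA [len v a0 * _]mulrC ler_wpM2l.
Qed.

End Growth.

(** With x = 2 ^ n and y = 2 ^ (2 n - 1), so that x ^ 2 = 2 y, the difference of
    the two sides is (x - 3) (y - 2). *)
Lemma cycle_count_le n : (2 <= n)%N -> (2 ^ n * (2 ^ (2 * n) - 1) <=
  3 * ((2 ^ n - 1) * (2 ^ (2 * n - 1) - 1) + 1))%N.
Proof.
move=> n2; have x4 : (4 <= 2 ^ n)%N by rewrite (leq_pexp2l (m := 2) (n1 := 2)).
have y2 : (2 <= 2 ^ (2 * n - 1))%N by rewrite (leq_pexp2l (m := 2) (n1 := 1)) //; lia.
have -> : (2 ^ (2 * n) = 2 * 2 ^ (2 * n - 1))%N.
  by rewrite -expnS; congr (2 ^ _)%N; lia.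
move: (2 ^ n)%N (2 ^ (2 * n - 1))%N x4 y2 => x y x4 y2; nia.
Qed.

Lemma valence_edge (G : graph) (x : vertex G) : (2 <= valence x)%N -> exists e : edge G, True.
Proof.
move=> vx; have /card_gt0P[a _] : (0 < valence x)%N by apply: ltnW.
by exists a.1.
Qed.

Theorem theorem23 (R : realType) (n : nat) (hn : (2 <= n)%N)
    (Phi : Out (Fr n)) (hPhi : irreducible_out Phi) (lam mu : R)
    (hlam : expansion_factor Phi lam) (hmu : expansion_factor (out_inv Phi) mu) :
  let K := ((2 ^ n - 1) * (2 ^ (2 * n - 1) - 1))%N in
  let A := (3 * (K + 1))%N in
  mu <= lam ^+ A.
Proof.
cbv zeta.
have [G [m [f [Gc Gval f_phi _ PF]]]] := hlam.
have [H [m' [h [Hc Hval h_psi tt PF']]]] := hmu.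
have [e _] := valence_edge (Gval (basepoint m)).
have [e' _] := valence_edge (Hval (basepoint m')).
have [v v0 v_lam] := perron_lengths PF; have [v' v'0 v_mu] := perron_lengths PF'.
have lam1 := perron_ge1 PF e.
have phi_psi g : exists x, repr Phi (repr (out_inv Phi) g) = (g ^ x)%g.
  have /out_classP[x xE] :
      out_class (inv_aut (repr Phi)) = out_class (repr (out_inv Phi)).
    by rewrite [RHS]reprK.
  exists (repr Phi x); rewrite xE autJ; congr (_ ^ _)%g; exact: autVK.
have le := train_track_growth_le Gc f_phi v0 v_lam lam1 phi_psi e' Hc h_psi tt v'0 v_mu.
apply: le_trans le _; rewrite ler_weXn2l //.
exact: leq_trans (card_cycles m Gc) (cycle_count_le hn).
Qed.
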